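(* Consider the $m$-step SSP multistep DG scheme $$\mathbf U_h^{n+1,(\mathrm{pre})}=\sum_{l=1}^m\left(\alpha_l\mathbf U_h^{n+1-l}+\beta_l\Delta t\,\mathcal L_h(\mathbf U_h^{n+1-l})\right),\qquad\alpha_l\ge0,\quad\sum_{l=1}^m\alpha_l=1,$$ where $\mathcal L_h$ is replaced by the downwind operator $\tilde{\mathcal L}_h$ whenever $\beta_l<0$. Let $\bar{\mathbf U}_i^{n+1}$ be the cell average of $\mathbf U_h^{n+1,(\mathrm{pre})}$ on $I_i$, $\lambda=\Delta t/h$, and define $$\mathcal U^{\mathrm{up}}=\sum_{l=1}^m\left(\alpha_l\,\tilde{\mathcal U}_i^{n+1-l}-\beta_l\lambda\big(\hat{\mathcal F}_{i+\frac12}^{n+1-l}-\hat{\mathcal F}_{i-\frac12}^{n+1-l}\big)\right),\quad\mathcal U^{\mathrm{high}}=\tilde{\mathcal U}_i^{n+1,(\mathrm{pre})},\quad\mathcal U^{\mathrm{1st}}=\mathcal U(\bar{\mathbf U}_i^{n+1}),$$ $$\theta_i=\min\left\{\frac{\mathcal U^{\mathrm{up}}-\mathcal U^{\mathrm{1st}}}{\mathcal U^{\mathrm{high}}-\mathcal U^{\mathrm{1st}}},\,1\right\}\quad(\theta_i=1\text{ if }\mathcal U^{\mathrm{high}}=\mathcal U^{\mathrm{1st}}),\qquad\mathbf U_h^{n+1}|_{I_i}=\bar{\mathbf U}_i^{n+1}+\theta_i\big(\mathbf U_h^{n+1,(\mathrm{pre})}|_{I_i}-\bar{\mathbf U}_i^{n+1}\big).$$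 If, for every cell, each forward Euler step of which the scheme is a convex combination satisfies the forward Euler weak-entropy CFL condition (defined in the context), then the limited solution satisfies the genuine cell entropy inequality $$\tilde{\mathcal U}_i^{n+1}\le\sum_{l=1}^m\left(\alpha_l\,\tilde{\mathcal U}_i^{n+1-l}-\beta_l\lambda\big(\hat{\mathcal F}_{i+\frac12}^{n+1-l}-\hat{\mathcal F}_{i-\frac12}^{n+1-l}\big)\right)\quad\text{for all }i,$$ and is globally entropy stable in the sense that $$\sum_i\tilde{\mathcal U}_i^{n+1}\le\sum_{l=1}^m\alpha_l\Big(\sum_i\tilde{\mathcal U}_i^{n+1-l}\Big)\le\max_{1\le l\le m}\sum_i\tilde{\mathcal U}_i^{n+1-l}.$$
   Context: **MHD system (flow varying in $x$ only).** The state is $\mathbf U=(\rho,\rho\mathbf u,\mathcal E,\mathbf B)\in\mathbb R^p$ with $\mathbf u,\mathbf B\in\mathbb R^M$ ($M\in\{1,2,3\}$, $p=2M+2$); $u_x,B_x$ are the first components of $\mathbf u,\mathbf B$. With $\gamma=5/3$, the pressure $P$ is defined by $\mathcal E=\frac{P}{\gamma-1}+\frac12\rho\|\mathbf u\|^2+\frac12\|\mathbf B\|^2$, and $P^\star=P+\frac12\|\mathbf B\|^2$. The admissible set is $G=\{\mathbf U:\rho>0,\ P>0\}$ (convex); all states, DG functions (including the predicted one) and paths take values in $G$. The $x$-flux is $\mathbf F(\mathbf U)=(\rho u_x,\ \rho u_x\mathbf u+P^\star\mathbf e_1-B_x\mathbf B,\ u_x(\mathcal E+P^\star)-B_x(\mathbf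 u\cdot\mathbf B),\ u_x\mathbf B-B_x\mathbf u)$. Entropy and entropy flux: $\mathcal U=-\frac{\rho s}{\gamma-1}$, $\mathcal F=-\frac{\rho su_x}{\gamma-1}$, $s=\ln(P\rho^{-\gamma})$; $\mathcal U$ is strictly convex on $G$ with positive definite Hessian. $\mathcal U'$ is the gradient as a row vector, $\mathbf V=\mathcal U'(\mathbf U)^T$. With $\beta=\rho/(2P)$, $\phi(\mathbf V)=2\beta(\mathbf u\cdot\mathbf B)$, set $\mathbf S(\mathbf U)=\phi'(\mathbf V)^T=(0,\mathbf B,\mathbf u\cdot\mathbf B,\mathbf u)^T$. $B_x'=\partial B_x/\partial\mathbf U$ is a constant row vector. One has $\mathcal F'=\mathcal U'\mathbf F'+\phi(\mathbf V)B_x'$ and $\mathcal U'\mathbf S=\phi$. The system discretized is $\partial_t\mathbf U+\partial_x\mathbf F(\mathbf U)=-\mathbf S(\mathbf U)\partial_xB_x$. **Paths.** A prescribed path is a Lipschitz function $\Psi(\xi;\mathbf U^-,\mathbf U^+)$, $\xi\in[0,1]$, with $\Psi(0;\cdot)=\mathbf U^-$, $\Psi(1;\cdot)=\mathbf U^+$, $\Psi(\xi;\mathbf U,\mathbf U)=\mathbf U$. A generalized path from $\mathbf a$ to $\mathbf b$ is a Lipschitz $\Phi:[0,1]\to G$ with $\Phi(0)=\mathbf a,\Phi(1)=\mathbf b$. Write $J(\Phi)=\int_0^1\mathbf S(\Phi(\xi))B_x'\Phi'(\xi)\,\mathrm d\xi$. **Wave speeds.** For $\mathbf a,\mathbf b\in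 G$ and a generalized path $\Phi$ from $\mathbf a$ to $\mathbf b$: $\mathcal S_R^{\rm std}=\max\{\sigma_{\max}(\mathbf F'(\mathbf a)),\sigma_{\max}(\mathbf F'(\mathbf b)),0\}$, $\mathcal S_L^{\rm std}=\min\{\sigma_{\min}(\mathbf F'(\mathbf a)),\sigma_{\min}(\mathbf F'(\mathbf b)),0\}$ (extreme eigenvalues). If $\mathbf a\neq\mathbf b$, with $\mathbf d=\mathbf b-\mathbf a$, $\mathbf e=\mathbf a-\mathbf b$, $$\mathcal S_R^{\rm ES}=\frac{\int_0^1\!\int_0^\xi\mathbf d^T\mathcal U''(\mathbf a+\zeta\mathbf d)\mathbf F'(\mathbf a+\xi\mathbf d)\mathbf d\,\mathrm d\zeta\mathrm d\xi+\int_0^1\mathcal U'(\mathbf a+\xi\mathbf d)\mathbf S(\mathbf a+\xi\mathbf d)B_x'\mathbf d\,\mathrm d\xi-\mathcal U'(\mathbf a)J(\Phi)}{\int_0^1\!\int_0^\xi\mathbf d^T\mathcal U''(\mathbf a+\zeta\mathbf d)\mathbf d\,\mathrm d\zeta\mathrm d\xi},$$ $$\mathcal S_L^{\rm ES}=\frac{\int_0^1\!\int_0^\xi\mathbf e^T\mathcal U''(\mathbf b+\zeta\mathbf e)\mathbf F'(\mathbf b+\xi\mathbf e)\mathbf e\,\mathrm d\zeta\mathrm d\xi+\int_0^1\mathcal U'(\mathbf b+\xi\mathbf e)\mathbf S(\mathbf b+\xi\mathbf e)B_x'\mathbf e\,\mathrm d\xi+\mathcal U'(\mathbf b)J(\Phi)}{\int_0^1\!\int_0^\xi\mathbf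 e^T\mathcal U''(\mathbf b+\zeta\mathbf e)\mathbf e\,\mathrm d\zeta\mathrm d\xi}.$$ The wave speeds of $(\mathbf a,\mathbf b;\Phi)$ are $\mathcal S_R=\max\{\mathcal S_R^{\rm std},\mathcal S_R^{\rm ES}\}$, $\mathcal S_L=\min\{\mathcal S_L^{\rm std},\mathcal S_L^{\rm ES}\}$; if $\mathbf a=\mathbf b$ the std values are used. It is understood that $\mathcal S_R>\mathcal S_L$. **Fluxes.** For $(\mathbf a,\mathbf b;\Phi)$: $\hat{\mathbf F}=\frac{\mathcal S_R\mathbf F(\mathbf a)-\mathcal S_L\mathbf F(\mathbf b)+\mathcal S_R\mathcal S_L(\mathbf b-\mathbf a)}{\mathcal S_R-\mathcal S_L}$, $\hat{\mathcal F}=\frac{\mathcal S_R\mathcal F(\mathbf a)-\mathcal S_L\mathcal F(\mathbf b)+\mathcal S_R\mathcal S_L(\mathcal U(\mathbf b)-\mathcal U(\mathbf a))}{\mathcal S_R-\mathcal S_L}$, $\mathcal R^+=\frac{\mathcal S_R}{\mathcal S_R-\mathcal S_L}$, $\mathcal R^-=\frac{-\mathcal S_L}{\mathcal S_R-\mathcal S_L}$, $\mathcal A^\pm=\mathcal R^\pm J(\Phi)$. **DG operator.** Uniform cells $I_i=[x_{i-1/2},x_{i+1/2}]$ of length $h$; $\mathbf V_h^k$ is the space of $\mathbb R^p$-valued piecewise polynomials of degree $\le k$. For $\mathbf U_h\in\mathbf V_h^k$ with one-sided limits $\mathbf U_{i+\frac12}^\pm$, let $\Psi_{i+\frac12}(\xi)=\Psi(\xi;\mathbf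 U^-_{i+\frac12},\mathbf U^+_{i+\frac12})$, and let $\hat{\mathbf F}_{i+\frac12},\hat{\mathcal F}_{i+\frac12},\mathcal D_{i+\frac12}^\pm=\mathcal R^\pm J(\Psi_{i+\frac12})$ be $\hat{\mathbf F},\hat{\mathcal F},\mathcal A^\pm$ for $(\mathbf U^-_{i+\frac12},\mathbf U^+_{i+\frac12};\Psi_{i+\frac12})$. $\mathcal L_h(\mathbf U_h)\in\mathbf V_h^k$ is defined by: for all $\mathbf W\in\mathbf V_h^k$ and all $i$, $$\int_{I_i}\mathcal L_h(\mathbf U_h)\cdot\mathbf W\,\mathrm dx=\int_{I_i}\mathbf F(\mathbf U_h)\cdot\partial_x\mathbf W\,\mathrm dx-\hat{\mathbf F}_{i+\frac12}\cdot\mathbf W^-_{i+\frac12}+\hat{\mathbf F}_{i-\frac12}\cdot\mathbf W^+_{i-\frac12}-\mathcal D^-_{i+\frac12}\cdot\mathbf W^-_{i+\frac12}-\mathcal D^+_{i-\frac12}\cdot\mathbf W^+_{i-\frac12}-\int_{I_i}\mathbf S(\mathbf U_h)\cdot\mathbf W\,\partial_xB_{x,h}\,\mathrm dx .$$ The downwind operator $\tilde{\mathcal L}_h$ is such that $-\tilde{\mathcal L}_h$ is the operator built by the same recipe for the time-reversed system (i.e. with $\mathbf F,\mathcal F,\mathbf S$ replaced by $-\mathbf F,-\mathcal F,-\mathbf S$); correspondingly, when $\beta_l<0$, $\hat{\mathcal F}^{n+1-l}$ is minus the numerical entropy flux of the reversed system. Superscripts $n+1-l$ denote evaluation at $\mathbf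 U_h^{n+1-l}$. **Discrete cell entropy.** $\hat x_1<\dots<\hat x_N$ ($N\ge k+1$) are the Gauss--Lobatto points on $I_i$ with weights $\sum_q\omega_q=1$; $\tilde{\mathcal U}_i^n=\sum_q\omega_q\,\mathcal U(\mathbf U_h^n(\hat x_q))$ (values taken from inside $I_i$), and $\tilde{\mathcal U}_i^{n+1,(\mathrm{pre})}$ is the same with $\mathbf U_h^{n+1,(\mathrm{pre})}$. Sums over $i$ are understood with boundary conditions (e.g. periodic) for which they are finite and the sum of flux differences telescopes to zero. **Three-point CFL quantity.** For $\mathbf a,\mathbf b,\mathbf c\in G$ and generalized paths $\Phi_1$ from $\mathbf a$ to $\mathbf b$, $\Phi_2$ from $\mathbf b$ to $\mathbf c$, let $T_3=\hat{\mathbf F}(\mathbf b,\mathbf c;\Phi_2)-\hat{\mathbf F}(\mathbf a,\mathbf b;\Phi_1)+\mathcal A^-(\mathbf b,\mathbf c;\Phi_2)+\mathcal A^+(\mathbf a,\mathbf b;\Phi_1)$, $T_1=\hat{\mathcal F}(\mathbf b,\mathbf c;\Phi_2)-\mathcal F(\mathbf b)-\mathcal U'(\mathbf b)(\hat{\mathbf F}(\mathbf b,\mathbf c;\Phi_2)-\mathbf F(\mathbf b)+\mathcal A^-(\mathbf b,\mathbf c;\Phi_2))$, $T_2=\hat{\mathcal F}(\mathbf a,\mathbf b;\Phi_1)-\mathcal F(\mathbf b)-\mathcal U'(\mathbf b)(\hat{\mathbf F}(\mathbf a,\mathbf b;\Phi_1)-\mathbf F(\mathbf b)-\mathcal A^+(\mathbf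 a,\mathbf b;\Phi_1))$. ''$\mu\le\mathscr T(\mathbf a,\mathbf b,\mathbf c;\Phi_1,\Phi_2)$'' means: $\mathbf b^{\rm new}=\mathbf b-\mu T_3\in G$ and either $T_3=0$ or $\mu\le\frac{2(T_2-T_1)}{\|T_3\|^2}(\max_{\boldsymbol\eta}\sigma_{\max}(\mathcal U''(\boldsymbol\eta)))^{-1}$, $\boldsymbol\eta$ ranging over the segment from $\mathbf b$ to $\mathbf b^{\rm new}$. ''$\mu\le\omega\mathscr T$'' means this with $\mu/\omega$ in place of $\mu$. **Forward Euler weak-entropy CFL condition** for a DG function $\mathbf U_h$ on $I_i$ with ratio $\mu$. Let $\Phi_i(\xi)=\mathbf U_h|_{I_i}(x_{i-\frac12}+\xi h)$ and $\mathbf U_q=\mathbf U_h|_{I_i}(\hat x_q)$. (1) If $\mathbf U^+_{i-\frac12}\ne\mathbf U^-_{i+\frac12}$: $\mu\le\omega_1\mathscr T(\mathbf U^-_{i-\frac12},\mathbf U^+_{i-\frac12},\mathbf U^-_{i+\frac12};\Psi_{i-\frac12},\Phi_i)$ and $\mu\le\omega_N\mathscr T(\mathbf U^+_{i-\frac12},\mathbf U^-_{i+\frac12},\mathbf U^+_{i+\frac12};\Phi_i,\Psi_{i+\frac12})$. (2a) If $\mathbf U^+_{i-\frac12}=\mathbf U^-_{i+\frac12}=\mathbf U_f$ and some $2\le s\le N-1$ has $\mathbf U_s\ne\mathbf U_f$: $\mu\le\omega_1\mathscr T(\mathbf U^-_{i-\frac12},\mathbf U^+_{i-\frac12},\mathbf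 U_s;\Psi_{i-\frac12},\Phi_i^L)$, $\mu\le\omega_s\mathscr T(\mathbf U^+_{i-\frac12},\mathbf U_s,\mathbf U^-_{i+\frac12};\Phi_i^L,\Phi_i^R)$, $\mu\le\omega_N\mathscr T(\mathbf U_s,\mathbf U^-_{i+\frac12},\mathbf U^+_{i+\frac12};\Phi_i^R,\Psi_{i+\frac12})$, where $\Phi_i^L,\Phi_i^R$ are the reparametrized portions of $\Phi_i$ over $[x_{i-\frac12},\hat x_s]$ and $[\hat x_s,x_{i+\frac12}]$. (2b) Otherwise ($\mathbf U_h|_{I_i}\equiv\mathbf U_f$): $\mu\le\mathscr T(\mathbf U^-_{i-\frac12},\mathbf U_f,\mathbf U^+_{i+\frac12};\Psi_{i-\frac12},\Psi_{i+\frac12})$. **Forward Euler steps of the multistep scheme.** The scheme is the convex combination, with weights $\alpha_l$, of the forward Euler steps $\mathbf U_h^{n+1-l}+\frac{\beta_l}{\alpha_l}\Delta t\,\mathcal L_h(\mathbf U_h^{n+1-l})$ (it is understood that $\beta_l=0$ if $\alpha_l=0$); the $l$-th step is required to satisfy the forward Euler weak-entropy CFL condition (whichever of the cases (1), (2a), (2b) applies) for the DG function $\mathbf U_h^{n+1-l}$ on $I_i$ with ratio $\mu=\frac{|\beta_l|}{\alpha_l}\lambda$ (for the reversed system if $\beta_l<0$). *)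

(* Defs.v *)
From HB Require Import structures.
From mathcomp Require Import all_boot all_order all_algebra.
From mathcomp Require Import all_classical all_reals all_analysis.

Set Implicit Arguments.
Unset Strict Implicit.
Unset Printing Implicit Defensive.

Import Order.TTheory GRing.Theory Num.Theory.
Import numFieldNormedType.Exports.

Local Open Scope classical_set_scope.
Local Open Scope ring_scope.

(* Vectors of R^n are row vectors 'rV[R]_n; a matrix A acts on (the transpose
   of) v by A *m v^T. *)
Section Calculus.
Context {R : realType}.

Definition dotv n (u v : 'rV[R]_n) : R := (u *m v^T) 0 0.

(* 'J f u is the matrix of the differential acting on rows by right
   multiplication; its transpose is the usual matrix of the d f_i / d u_j. *)
Definition jac n m (f : 'rV[R]_n -> 'rV[R]_m) (u : 'rV[R]_n) : 'M[R]_(m, n) :=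
  ('J f u)^T.

Definition grad n (f : 'rV[R]_n -> R) (u : 'rV[R]_n) : 'rV[R]_n :=
  \row_j 'D_(delta_mx 0 j) f u.

Definition hess n (f : 'rV[R]_n -> R) (u : 'rV[R]_n) : 'M[R]_n :=
  jac (grad f) u.

(* Extreme real eigenvalues; the set of eigenvalues is finite, so for a matrix
   with a real eigenvalue sup and inf are a maximum and a minimum. *)
Definition sigma_max n (A : 'M[R]_n) : R := sup [set z | eigenvalue A z].
Definition sigma_min n (A : 'M[R]_n) : R := inf [set z | eigenvalue A z].

Definition integ (a b : R) (f : R -> R) : R :=
  \int[@lebesgue_measure R]_(x in `[a, b]) f x.

Definition vinteg n (a b : R) (f : R -> 'rV[R]_n) : 'rV[R]_n :=
  \row_j integ a b (fun x => f x 0 j).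

End Calculus.

(* The space dimension is M.+1, so that the x components of u and B always
   exist.  A state is the row (rho, rho u, E, B). *)
Notation dimU M := (1 + (M.+1 + (1 + M.+1)))%N (only parsing).
Notation state R M := 'rV[R]_(dimU M) (only parsing).

Section MHD.
Context {R : realType} {M : nat}.
Implicit Types U : state R M.

Definition mk_state (rho : R) (m : 'rV[R]_M.+1) (E : R) (B : 'rV[R]_M.+1) :
    state R M :=
  row_mx rho%:M (row_mx m (row_mx E%:M B)).

Definition density U : R := lsubmx U 0 0.
Definition momentum U : 'rV[R]_M.+1 := lsubmx (rsubmx U).
Definition energy U : R := lsubmx (rsubmx (rsubmx U)) 0 0.
Definition magnetic U : 'rV[R]_M.+1 := rsubmx (rsubmx (rsubmx U)).
Definition velocity U : 'rV[R]_M.+1 := (density U)^-1 *: momentum U.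
Definition vel_x U : R := velocity U 0 0.
Definition mag_x U : R := magnetic U 0 0.

Definition gamma : R := 5%:R / 3%:R.

(* E = P / (gamma - 1) + rho |u|^2 / 2 + |B|^2 / 2, solved for P *)
Definition pressure U : R :=
  (gamma - 1) * (energy U - density U * dotv (velocity U) (velocity U) / 2%:R
                 - dotv (magnetic U) (magnetic U) / 2%:R).

Definition total_pressure U : R :=
  pressure U + dotv (magnetic U) (magnetic U) / 2%:R.

Definition G : set (state R M) := [set U | 0 < density U /\ 0 < pressure U].

Definition mhd_flux U : state R M :=
  mk_state
    (density U * vel_x U)
    ((density U * vel_x U) *: velocity U
     + total_pressure U *: delta_mx 0 0 - mag_x U *: magnetic U)
    (vel_x U * (energy U + total_pressure U)
     - mag_x U * dotv (velocity U) (magnetic U))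
    (vel_x U *: magnetic U - mag_x U *: velocity U).

Definition spec_entropy U : R := ln (pressure U * density U `^ (- gamma)).
Definition entropy U : R := - (density U * spec_entropy U) / (gamma - 1).
Definition mhd_eflux U : R :=
  - (density U * spec_entropy U * vel_x U) / (gamma - 1).

Definition mhd_source U : state R M :=
  mk_state 0 (magnetic U) (dotv (velocity U) (magnetic U)) (velocity U).

(* the constant row vector d B_x / d U *)
Definition dmag_x : state R M := mk_state 0 0 0 (delta_mx 0 0).

End MHD.

(* A system d_t U + d_x (flux U) = - source U d_x B_x with entropy flux eflux
   (for the entropy above); [reversed] is its time reversal. *)
Record system (R : realType) (M : nat) := System {
  flux : state R M -> state R M;
  eflux : state R M -> R;
  source : state R M -> state R M }.

Definition mhd (R : realType) (M : nat) : system R M :=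
  System mhd_flux mhd_eflux mhd_source.

Definition reversed (R : realType) (M : nat) (L : system R M) : system R M :=
  System (fun U => - flux L U) (fun U => - eflux L U) (fun U => - source L U).

(* Paths are functions on R of which only the values on [0, 1] matter. *)
Section Paths.
Context {R : realType} {M : nat}.

Definition generalized_path (a b : state R M) (Phi : R -> state R M) : Prop :=
  [/\ [lipschitz Phi xi | xi in `[0, 1]],
      forall xi, 0 <= xi <= 1 -> G (Phi xi),
      Phi 0 = a & Phi 1 = b].

Definition prescribed_path (Psi : R -> state R M -> state R M -> state R M) :
    Prop :=
  (forall a b, G a -> G b -> generalized_path a b (fun xi => Psi xi a b)) /\
  (forall a, G a -> forall xi, 0 <= xi <= 1 -> Psi xi a a = a).

End Paths.

Section RiemannFluxes.
Context {R : realType} {M : nat} (L : system R M).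
Implicit Types (a b c : state R M) (Phi : R -> state R M).

Definition pathJ Phi : state R M :=
  vinteg 0 1 (fun xi => dotv dmag_x (derive1 Phi xi) *: source L (Phi xi)).

Definition SR_std a b : R :=
  Num.max (Num.max (sigma_max (jac (flux L) a)) (sigma_max (jac (flux L) b))) 0.

Definition SL_std a b : R :=
  Num.min (Num.min (sigma_min (jac (flux L) a)) (sigma_min (jac (flux L) b))) 0.

(* int_0^1 int_0^xi d^T U''(a + zeta d) A(xi) d dzeta dxi *)
Definition hess_integral a (d : state R M) (A : R -> 'M[R]_(dimU M)) : R :=
  integ 0 1 (fun xi => integ 0 xi (fun zeta =>
    (d *m hess entropy (a + zeta *: d) *m A xi *m d^T) 0 0)).

Definition source_integral a (d : state R M) : R :=
  integ 0 1 (fun xi =>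
    dotv (grad entropy (a + xi *: d)) (source L (a + xi *: d))
    * dotv dmag_x d).

Definition SR_ES a b Phi : R :=
  let d := b - a in
  (hess_integral a d (fun xi => jac (flux L) (a + xi *: d))
   + source_integral a d - dotv (grad entropy a) (pathJ Phi))
  / hess_integral a d (fun=> 1%:M).

Definition SL_ES a b Phi : R :=
  let e := a - b in
  (hess_integral b e (fun xi => jac (flux L) (b + xi *: e))
   + source_integral b e + dotv (grad entropy b) (pathJ Phi))
  / hess_integral b e (fun=> 1%:M).

Definition SR a b Phi : R :=
  if a == b then SR_std a b else Num.max (SR_std a b) (SR_ES a b Phi).

Definition SL a b Phi : R :=
  if a == b then SL_std a b else Num.min (SL_std a b) (SL_ES a b Phi).

Definition num_flux a b Phi : state R M :=
  let sr := SR a b Phi in let sl := SL a b Phi in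
  (sr - sl)^-1 *: (sr *: flux L a - sl *: flux L b + (sr * sl) *: (b - a)).

Definition num_eflux a b Phi : R :=
  let sr := SR a b Phi in let sl := SL a b Phi in
  (sr * eflux L a - sl * eflux L b + sr * sl * (entropy b - entropy a))
  / (sr - sl).

Definition fluct_pos a b Phi : state R M :=
  (SR a b Phi / (SR a b Phi - SL a b Phi)) *: pathJ Phi.

Definition fluct_neg a b Phi : state R M :=
  (- SL a b Phi / (SR a b Phi - SL a b Phi)) *: pathJ Phi.

Definition T3 a b c Phi1 Phi2 : state R M :=
  num_flux b c Phi2 - num_flux a b Phi1 + fluct_neg b c Phi2
  + fluct_pos a b Phi1.

Definition T1 b c Phi2 : R :=
  num_eflux b c Phi2 - eflux L b
  - dotv (grad entropy b) (num_flux b c Phi2 - flux L b + fluct_neg b c Phi2).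

Definition T2 a b Phi1 : R :=
  num_eflux a b Phi1 - eflux L b
  - dotv (grad entropy b) (num_flux a b Phi1 - flux L b - fluct_pos a b Phi1).

(* maximum over the segment [b, b'] of the largest eigenvalue of the Hessian of
   the entropy (continuous there, so sup is a maximum) *)
Definition max_hess_eig b (b' : state R M) : R :=
  sup [set sigma_max (hess entropy (b + t *: (b' - b))) | t in `[0, 1]].

Definition cfl3 (mu : R) a b c Phi1 Phi2 : Prop :=
  let t3 := T3 a b c Phi1 Phi2 in
  let bnew := b - mu *: t3 in
  G bnew /\
  (t3 = 0 \/
   mu <= 2%:R * (T2 a b Phi1 - T1 b c Phi2) / dotv t3 t3
         * (max_hess_eig b bnew)^-1).

End RiemannFluxes.

(* Gauss--Lobatto rule with N.+2 points on [0, 1], in increasing order: both end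
   points are nodes and the rule is exact in degree <= 2 (N.+2) - 3. *)
Definition gauss_lobatto (R : realType) (N : nat) (xhat w : 'I_N.+2 -> R) :
    Prop :=
  [/\ forall q r : 'I_N.+2, (q < r)%N -> xhat q < xhat r,
      xhat ord0 = 0,
      xhat ord_max = 1 &
      forall f : {poly R}, (size f <= (N.+2).*2 - 2)%N ->
        \sum_(q < N.+2) w q * f.[xhat q] = integ 0 1 (fun x => f.[x])].

(* A piecewise polynomial: the polynomial (in the global variable x) on each
   cell.  Cell i : int is [x_{i-1/2}, x_{i+1/2}] with x_{i-1/2} = x0 + i h, and
   the interface x_{i-1/2} has index i. *)
Notation dgfun R M := (int -> 'rV[{poly R}]_(dimU M)) (only parsing).

Section DG.
Context {R : realType} {M : nat}.
Variables (x0 h : R) (Psi : R -> state R M -> state R M -> state R M).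
Implicit Types (U W LU : dgfun R M) (i j : int) (L : system R M).

Definition peval (f : 'rV[{poly R}]_(dimU M)) (x : R) : state R M :=
  map_mx (horner_eval x) f.

Definition pderiv (f : 'rV[{poly R}]_(dimU M)) : 'rV[{poly R}]_(dimU M) :=
  map_mx (@deriv R) f.

Definition pconst (u : state R M) : 'rV[{poly R}]_(dimU M) := map_mx polyC u.

Definition xface j : R := x0 + j%:~R * h.

Definition in_Vh (k : nat) U : Prop :=
  forall i c, (size (U i 0%R c) <= k.+1)%N.

Definition admissible_on U i : Prop :=
  forall x, xface i <= x <= xface (i + 1) -> G (peval (U i) x).

Definition trace_minus U j : state R M := peval (U (j - 1)) (xface j).
Definition trace_plus U j : state R M := peval (U j) (xface j).

Definition face_path U j : R -> state R M :=
  fun xi => Psi xi (trace_minus U j) (trace_plus U j).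

Definition face_flux L U j : state R M :=
  num_flux L (trace_minus U j) (trace_plus U j) (face_path U j).

Definition face_eflux L U j : R :=
  num_eflux L (trace_minus U j) (trace_plus U j) (face_path U j).

Definition face_pos L U j : state R M :=
  fluct_pos L (trace_minus U j) (trace_plus U j) (face_path U j).

Definition face_neg L U j : state R M :=
  fluct_neg L (trace_minus U j) (trace_plus U j) (face_path U j).

Definition is_DG_operator (k : nat) L U LU : Prop :=
  in_Vh k LU /\
  forall W, in_Vh k W -> forall i,
    integ (xface i) (xface (i + 1))
      (fun x => dotv (peval (LU i) x) (peval (W i) x)) =
    integ (xface i) (xface (i + 1))
      (fun x => dotv (flux L (peval (U i) x)) (peval (pderiv (W i)) x))
    - dotv (face_flux L U (i + 1)) (trace_minus W (i + 1))
    + dotv (face_flux L U i) (trace_plus W i)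
    - dotv (face_neg L U (i + 1)) (trace_minus W (i + 1))
    - dotv (face_pos L U i) (trace_plus W i)
    - integ (xface i) (xface (i + 1))
        (fun x => dotv (source L (peval (U i) x)) (peval (W i) x)
                  * mag_x (peval (pderiv (U i)) x)).

Definition cell_average U i : state R M :=
  h^-1 *: vinteg (xface i) (xface (i + 1)) (peval (U i)).

(* the portion of U_h|_{I_i} over [y, z], parametrized by [0, 1] *)
Definition cell_path U i (y z : R) : R -> state R M :=
  fun xi => peval (U i) (y + xi * (z - y)).

Section Quadrature.
Variables (N : nat) (xhat w : 'I_N.+2 -> R).

Definition node i (q : 'I_N.+2) : R := xface i + xhat q * h.

Definition cell_entropy U i : R :=
  \sum_(q < N.+2) w q * entropy (peval (U i) (node i q)).

Definition weak_entropy_cfl L U i (mu : R) : Prop :=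
  let ULm := trace_minus U i in
  let ULp := trace_plus U i in
  let URm := trace_minus U (i + 1) in
  let URp := trace_plus U (i + 1) in
  let PsiL := face_path U i in
  let PsiR := face_path U (i + 1) in
  let Phi := cell_path U i (xface i) (xface (i + 1)) in
  let Uq s := peval (U i) (node i s) in
  let PhiL s := cell_path U i (xface i) (node i s) in
  let PhiR s := cell_path U i (node i s) (xface (i + 1)) in
  let interior (s : 'I_N.+2) := (0 < s < N.+1)%N in
  [/\ ULp <> URm ->
        cfl3 L (mu / w ord0) ULm ULp URm PsiL Phi /\
        cfl3 L (mu / w ord_max) ULp URm URp Phi PsiR,
      ULp = URm -> (exists2 s, interior s & Uq s <> ULp) ->
        exists s, [/\ interior s, Uq s <> ULp,
          cfl3 L (mu / w ord0) ULm ULp (Uq s) PsiL (PhiL s),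
          cfl3 L (mu / w s) ULp (Uq s) URm (PhiL s) (PhiR s) &
          cfl3 L (mu / w ord_max) (Uq s) URm URp (PhiR s) PsiR] &
      ULp = URm -> (forall s, interior s -> Uq s = ULp) ->
        cfl3 L mu ULm ULp URp PsiL PsiR].

End Quadrature.

(* System, spatial operator and numerical entropy flux used by a stage with
   coefficient [beta]: the downwind ones when beta < 0. *)
Definition stage_system (beta : R) : system R M :=
  if beta < 0 then reversed (mhd R M) else mhd R M.

Definition is_stage_operator (k : nat) (beta : R) U LU : Prop :=
  is_DG_operator k (stage_system beta) U
    (if beta < 0 then (fun i => - LU i) else LU).

Definition stage_eflux (beta : R) U j : R :=
  if beta < 0 then - face_eflux (stage_system beta) U j
  else face_eflux (stage_system beta) U j.

(* The m.+1-step scheme: U l is the solution at time level n - l and LU l its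
   spatial operator, l = 0, ..., m. *)
Section Multistep.
Variables (N : nat) (xhat w : 'I_N.+2 -> R) (dt : R) (m : nat).
Variables (alpha beta : 'I_m.+1 -> R) (U LU : 'I_m.+1 -> dgfun R M).

Definition predicted : dgfun R M := fun i =>
  \sum_(l < m.+1) ((alpha l)%:P *: U l i + (beta l * dt)%:P *: LU l i).

Definition entropy_up i : R :=
  \sum_(l < m.+1)
    (alpha l * cell_entropy xhat w (U l) i
     - beta l * (dt / h) * (stage_eflux (beta l) (U l) (i + 1)
                            - stage_eflux (beta l) (U l) i)).

Definition entropy_high i : R := cell_entropy xhat w predicted i.

Definition entropy_1st i : R := entropy (cell_average predicted i).

Definition theta i : R :=
  if entropy_high i == entropy_1st i then 1
  else Num.min ((entropy_up i - entropy_1st i)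
                / (entropy_high i - entropy_1st i)) 1.

Definition limited : dgfun R M := fun i =>
  let avg := pconst (cell_average predicted i) in
  avg + (theta i)%:P *: (predicted i - avg).

End Multistep.
End DG.

(* Sum over a (finite or infinite) set of cells; meaningful when f is summable
   on I, and an ordinary sum when I is finite. *)
Definition summable_on (R : realType) (I : set int) (f : int -> R) : Prop :=
  summable I (EFin \o f).

Definition cell_sum (R : realType) (I : set int) (f : int -> R) : R :=
  fine (\esum_(i in I) (EFin \o f)^\+ i - \esum_(i in I) (EFin \o f)^\- i)%E.

(* Main.v *)
Require Import Defs.
From mathcomp Require Import all_boot all_order all_algebra.
From mathcomp Require Import all_classical all_reals all_analysis.
From mathcomp Require Import measurable_realfun zify ring lra.

Set Implicit Arguments.
Unset Strict Implicit.
Unset Printing Implicit Defensive.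

Import Order.TTheory GRing.Theory Num.Theory.
Import numFieldNormedType.Exports.

Local Open Scope classical_set_scope.
Local Open Scope ring_scope.

(* On G the Hessian of the entropy is symmetric, and F_ent' = V . F' + (V . S) B_x'
   with V the entropy gradient.  Integrating by the fundamental theorem of calculus
   along the segment, the entropy-stable speed S_R^ES becomes
   (Delta F_ent - V(a) . Delta F - V(a) . J) / (relative entropy), and similarly
   for S_L^ES; since the relative entropy is positive, S_R >= S_R^ES and
   S_L <= S_L^ES say exactly T1 <= 0 <= T2.  A second-order Taylor expansion and
   the Rayleigh quotient then give the entropy inequality for a three-point
   scheme.  By exactness of the Gauss-Lobatto rule, a forward Euler step of a cell
   average is a convex combination of such three-point schemes at the nodes, the
   volume source term being split between them since the two fluctuations of an
   interface add up to J.  Jensen's inequality, applied to the nodes and then to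
   the multistep combination, yields U^1st <= U^up, and convexity shows that the
   limiter brings the cell entropy below U^up. *)

(** * Continuously differentiable functions *)

(** The delicate case is that of equal states. The entropy-stable speeds enter only for a <> b; for
    a = b the one-sided entropy inequalities are obtained from J = 0. A prescribed path between
    equal states is constant, so interfaces are harmless, but the polynomial path across a cell may
    return to its starting value with J <> 0. It is then cut at an interior node carrying another
    value; if there is none, the polynomial, which has fewer degrees of freedom than there are nodes
    to match, is constant and the source disappears. Downwind stages need no separate argument: the
    relation between flux, entropy flux and source is linear in the three together, and time
    reversal leaves the entropy unchanged, so the estimates are proved for any [entropic] system.
    Differentials are carried as explicit formulas, which turns the symmetry of the Hessian and the
    compatibility of the fluxes into rational identities in a few dot products. Strict positivity of
    the relative entropy is likewise read off a closed formula. *)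

Section ContinuouslyDifferentiable.
Context {R : realType} (n : nat) (D : set 'rV[R]_n).
Implicit Types (f g : 'rV[R]_n -> R) (df dg : 'rV[R]_n -> 'rV[R]_n -> R).

(** The second argument of [df] is a direction. Continuity is asked for each fixed direction only,
    which is what the fundamental theorem of calculus on a segment uses. *)
Definition C1 f df := forall U, D U ->
  is_diff U f (df U) /\ forall v, {for U, continuous (df ^~ v)}.

Lemma C1_continuous f df U : C1 f df -> D U -> {for U, continuous f}.
Proof. by move=> h /h[[/differentiable_continuous]]. Qed.

Lemma C1_eq f df f' df' : C1 f df -> (forall U, f U = f' U) ->
  (forall U v, df U v = df' U v) -> C1 f' df'.
Proof.
move=> h /funext <- e; suff -> : df' = df by [].
by apply/funext => U; apply/funext => v.
Qed.

Lemma C1_cst c : C1 (fun=> c) (fun _ _ => 0).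
Proof. by move=> U _; split; [exact: (is_diff_eq (is_diff_cst c U))|move=> v; exact: cst_continuous]. Qed.

Lemma C1_coord j : C1 (fun U => U 0 j) (fun _ v => v 0 j).
Proof.
move=> U _; split; last by move=> v; exact: cst_continuous.
have dj : differentiable (fun U : 'rV[R]_n => U 0 j) U.
  exact: differentiable_coord.
apply: DiffDef => //; apply/funext => v; rewrite -deriveE//.
have := @derive_mx R _ 1 n id U v (@derivable_id _ _ _ _).
by rewrite derive_id => /matrixP/(_ 0 j); rewrite mxE.
Qed.

Lemma C1D f g df dg : C1 f df -> C1 g dg ->
  C1 (fun U => f U + g U) (fun U v => df U v + dg U v).
Proof.
move=> hf hg U DU; have [? cf] := hf _ DU; have [? cg] := hg _ DU.
by split; [exact: is_diffD|move=> v; exact: continuousD (cf v) (cg v)].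
Qed.

Lemma C1N f df : C1 f df -> C1 (fun U => - f U) (fun U v => - df U v).
Proof.
move=> hf U DU; have [? cf] := hf _ DU.
by split; [exact: is_diffN|move=> v; exact: continuousN (cf v)].
Qed.

Lemma C1M f g df dg : C1 f df -> C1 g dg ->
  C1 (fun U => f U * g U) (fun U v => f U * dg U v + g U * df U v).
Proof.
move=> hf hg U DU; have [? cf] := hf _ DU; have [? cg] := hg _ DU.
split; first exact: is_diffM.
have cf0 := C1_continuous hf DU; have cg0 := C1_continuous hg DU.
move=> v; exact: continuousD (continuousM cf0 (cg v)) (continuousM cg0 (cf v)).
Qed.

Lemma C1_comp (phi phi' : R -> R) f df :
  C1 f df -> (forall U, D U -> is_derive (f U) 1 phi (phi' (f U))) ->
  (forall U, D U -> {for f U, continuous phi'}) ->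
  C1 (fun U => phi (f U)) (fun U v => phi' (f U) * df U v).
Proof.
move=> hf hp cp U DU; have [dfU cf] := hf _ DU; have [dp ep] := hp _ DU.
split.
  have dphi : is_diff (f U) phi ( *:%R^~ (phi' (f U)) : R -> R).
    apply: DiffDef; first exact/derivable1_diffP.
    by rewrite deriv1E// derive1E ep.
  have := @is_diff_comp _ _ _ _ _ _ _ _ _ dfU dphi.
  by move=> hh; apply: (is_diff_eq hh); apply/funext => v /=; rewrite mulrC.
move=> v; apply: (@continuousM _ _ (phi' \o f)); last exact: cf.
by apply: continuous_comp; [exact: C1_continuous hf DU|exact: cp].
Qed.

Lemma C1V f df : C1 f df -> (forall U, D U -> f U != 0) ->
  C1 (fun U => (f U)^-1) (fun U v => - (f U)^-2 * df U v).
Proof.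
move=> hf f0; apply: (@C1_comp GRing.inv (fun x => - x^-2)) => // U DU.
  apply: DeriveDef.
    apply/derivable1_diffP; apply: differentiable_Rinv; exact: f0.
  rewrite -derive1E derive1E deriveE; last exact/differentiable_Rinv/f0.
  by rewrite diff_Rinv ?f0// /GRing.scale/= mulr1.
apply: cvgN; apply: cvgV; first by rewrite expf_neq0// f0.
exact: exprn_continuous.
Qed.

Lemma C1_ln f df : C1 f df -> (forall U, D U -> 0 < f U) ->
  C1 (fun U => ln (f U)) (fun U v => (f U)^-1 * df U v).
Proof.
move=> hf f0; apply: (@C1_comp (@ln R) GRing.inv) => // U DU.
  exact/is_derive1_ln/f0.
by apply: inv_continuous; rewrite gt_eqF// f0.
Qed.

Lemma C1_sum m (f : 'I_m -> 'rV[R]_n -> R)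
    (df : 'I_m -> 'rV[R]_n -> 'rV[R]_n -> R) : (forall i, C1 (f i) (df i)) ->
  C1 (fun U => \sum_i f i U) (fun U v => \sum_i df i U v).
Proof.
elim: m f df => [|m IH] f df h.
  by apply: (C1_eq (C1_cst 0)) => *; rewrite big_ord0.
apply: (C1_eq (C1D (IH _ _ (fun i => h (widen_ord (leqnSn m) i)))
  (h ord_max))) => *; by rewrite big_ord_recr.
Qed.

(** A differential depends only on the germ. Applied to [g - f] in [C1_eq_on], this lets a formula
    valid only on an open set be differentiated there. *)
Lemma is_diff_eq0_near (k : 'rV[R]_n -> R) U :
  (\forall X \near U, k X = 0) -> is_diff U k (0 : 'rV[R]_n -> R).
Proof.
move=> k0; have kU : k U = 0 by apply: nbhs_singleton k0.
have c0 : continuous (0 : 'rV[R]_n -> R) by exact: cst_continuous.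
have e : k \o shift U = cst (k U) + (0 : 'rV[R]_n -> R) +o_ 0 id.
  apply/eqaddoP => _ /posnumP[e].
  have : \forall y \near (0 : 'rV[R]_n), k (y + U) = 0.
    by move: k0; rewrite (near_shift 0 U) subr0.
  apply: filterS => y ky.
  by rewrite !fctE /= ky kU addr0 subrr normr0 mulr_ge0.
have d0 : 'd k U = (0 : 'rV[R]_n -> R) :> (_ -> _).
  exact: (diff_unique (df := \0) c0 e).
by apply: DiffDef => //; apply/diff_locallyP; rewrite d0.
Qed.

(** Serves formulas that hold only on [G]: the splitting of ln (P rho^-gamma), and the closed form
    of [grad entropy]. *)
Lemma C1_eq_on f g df : open D -> C1 f df -> (forall U, D U -> f U = g U) ->
  C1 g df.
Proof.
move=> oD hf fg U DU; have [dfU cf] := hf _ DU; split => //.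
have k0 : \forall X \near U, (g - f) X = 0.
  by move/open_nbhs_nbhs: (conj oD DU); apply: filterS => X DX; rewrite !fctE fg ?subrr.
have dk := is_diff_eq0_near k0.
have -> : g = f + (g - f) by apply/funext => X; rewrite !fctE addrC subrK.
by apply: is_diff_eq (is_diffD dfU dk) _; rewrite addr0.
Qed.

Definition C1v m (f : 'rV[R]_n -> 'rV[R]_m)
    (df : 'rV[R]_n -> 'rV[R]_n -> 'rV[R]_m) :=
  forall j, C1 (fun U => f U 0 j) (fun U v => df U v 0 j).

Section Vector.
Context (m : nat).
Implicit Types (F H : 'rV[R]_n -> 'rV[R]_m)
  (dF dH : 'rV[R]_n -> 'rV[R]_n -> 'rV[R]_m).

Lemma C1v_eq F dF F' dF' : C1v F dF -> (forall U, F U = F' U) ->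
  (forall U v, dF U v = dF' U v) -> C1v F' dF'.
Proof. by move=> h e e' j; apply: C1_eq (h j) _ _ => *; rewrite ?e ?e'. Qed.

Lemma C1vD F H dF dH : C1v F dF -> C1v H dH ->
  C1v (fun U => F U + H U) (fun U v => dF U v + dH U v).
Proof.
by move=> hF hH j; apply: C1_eq (C1D (hF j) (hH j)) _ _ => *; rewrite !mxE.
Qed.

Lemma C1vN F dF : C1v F dF -> C1v (fun U => - F U) (fun U v => - dF U v).
Proof. by move=> hF j; apply: C1_eq (C1N (hF j)) _ _ => *; rewrite !mxE. Qed.

Lemma C1v_cst c : C1v (fun=> c : 'rV[R]_m) (fun _ _ => 0).
Proof. by move=> j; apply: C1_eq (C1_cst (c 0 j)) _ _ => *; rewrite ?mxE. Qed.

Lemma C1vZ f df F dF : C1 f df -> C1v F dF ->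
  C1v (fun U => f U *: F U) (fun U v => f U *: dF U v + df U v *: F U).
Proof.
move=> hf hF j; apply: C1_eq (C1M hf (hF j)) _ _ => *; rewrite !mxE//.
by rewrite [df _ _ * _]mulrC.
Qed.

Lemma dotvE (u v : 'rV[R]_m) : dotv u v = \sum_j u 0 j * v 0 j.
Proof. by rewrite /dotv mxE; apply: eq_bigr => j _; rewrite mxE. Qed.

Lemma C1_dotv F H dF dH : C1v F dF -> C1v H dH ->
  C1 (fun U => dotv (F U) (H U))
     (fun U v => dotv (F U) (dH U v) + dotv (dF U v) (H U)).
Proof.
move=> hF hH; apply: C1_eq (C1_sum (fun j => C1M (hF j) (hH j))) _ _ => *.
  by rewrite dotvE.
by rewrite !dotvE -big_split; apply: eq_bigr => j _; rewrite [dF _ _ _ _ * _]mulrC.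
Qed.

Lemma C1v_diff F dF U : C1v F dF -> D U ->
  differentiable F U /\ forall v, 'd F U v = dF U v.
Proof.
move=> hF DU; have dFU : differentiable F U.
  have -> : F = \sum_j (fun X => F X 0 j *: (delta_mx 0 j : 'rV[R]_m)).
    by apply/funext => X; rewrite fct_sumE {1}[F X]row_sum_delta.
  apply: differentiable_sum => j; apply: differentiableZl.
  by have [[]] := hF j _ DU.
split=> // v; rewrite -deriveE// derive_mx; last exact: diff_derivable.
apply/rowP => j; rewrite mxE; have [[dj e] _] := hF j _ DU.
by rewrite deriveE// e.
Qed.

Lemma jac_mul F dF U z : C1v F dF -> D U -> jac F U *m z^T = (dF U z)^T.
Proof.
move=> hF DU; have [_ <-] := C1v_diff hF DU.
by rewrite /jac -trmx_mul /jacobian mul_rV_lin1.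
Qed.

End Vector.

Lemma grad_coord f df U j : C1 f df -> D U -> grad f U 0 j = df U (delta_mx 0 j).
Proof. by move=> hf /hf[[df0 e] _]; rewrite mxE deriveE// e. Qed.

Lemma is_derive_segment f df a d t : C1 f df -> D (a + t *: d) ->
  is_derive t 1 (fun s => f (a + s *: d)) (df (a + t *: d) d).
Proof.
move=> hf /hf[[dft e] _].
(* The difference quotient along the line is literally the directional one of [f] along [d], so no
   chain rule is needed. *)
have E : (fun h : R => h^-1 *: (((fun s => f (a + s *: d)) \o shift t) (h *: 1)
             - f (a + t *: d))) =
         (fun h : R => h^-1 *: ((f \o shift (a + t *: d)) (h *: d)
             - f (a + t *: d))).
  apply/funext => h /=; congr (_ *: (f _ - _)).
  by rewrite (_ : h *: 1 = h) ?scalerDl 1?addrCA//; exact: mulr1.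
apply: DeriveDef; first by have := @diff_derivable _ _ _ _ _ d dft; rewrite /derivable E.
have := @deriveE _ _ _ f (a + t *: d) d dft; rewrite e => <-.
by rewrite /derive E.
Qed.

Lemma for_continuous_segment f a d t : {for a + t *: d, continuous f} ->
  {for t, continuous (fun s : R => f (a + s *: d))}.
Proof.
move=> cf; apply: (@continuous_comp _ _ _ (fun s : R => a + s *: d) f) => //.
apply: continuousD; first exact: cst_continuous.
by apply: continuousZr_tmp; exact: cvg_id.
Qed.

End ContinuouslyDifferentiable.

(** * Integrals of functions continuous on a segment *)

Section Integ.
Context {R : realType}.
Implicit Types (x y : R) (f g F : R -> R).

(** Two-sided continuity even at the end points: it is available because the integrands are
    polynomial or live on the open set [G]. *)
Definition cont_on x y f := forall t, x <= t <= y -> {for t, continuous f}.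

Lemma cont_on_within x y f : cont_on x y f -> {within `[x, y], continuous f}.
Proof.
by move=> cf; apply: continuous_in_subspaceT => t; rewrite inE /= in_itv => /cf.
Qed.

Lemma cont_on_integrable x y f : cont_on x y f ->
  (@lebesgue_measure R).-integrable `[x, y] (EFin \o f).
Proof.
move=> cf; apply: continuous_compact_integrable; first exact: segment_compact.
exact: cont_on_within.
Qed.

Lemma integ_deriv x y F f : x <= y ->
  (forall t, x <= t <= y -> is_derive t 1 F (f t)) -> cont_on x y f ->
  integ x y f = F y - F x.
Proof.
rewrite le_eqVlt => /predU1P[->|xy] dF cf.
  by rewrite /integ set_itv1 Rintegral_set1 subrr.
rewrite /integ /Rintegral (@continuous_FTC2 _ f F)//.
- exact: cont_on_within.
- have cF t : x <= t <= y -> F @ t --> F t.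
    by move=> /dF[/derivable1_diffP/differentiable_continuous].
  split.
  + by move=> t; rewrite in_itv/= => /andP[/ltW ? /ltW ?]; case: (dF t); rewrite ?xt//; apply/andP.
  + by apply: cvg_at_right_filter; apply: cF; rewrite lexx ltW.
  + by apply: cvg_at_left_filter; apply: cF; rewrite lexx ltW.
- move=> t; rewrite in_itv/= => /andP[/ltW xt /ltW ty].
  by have [_] := dF t (introT andP (conj xt ty)); rewrite derive1E.
Qed.

Lemma eq_integ x y f g : (forall t, x <= t <= y -> f t = g t) ->
  integ x y f = integ x y g.
Proof.
by move=> e; apply: eq_Rintegral => t; rewrite inE/= in_itv/= => /e.
Qed.

(** The end points are negligible. They must be excluded for path integrals: the derivative of a
    path at 0 or 1 involves its values outside [0, 1], which are arbitrary. *)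
Lemma eq_integ_oo x y f g : cont_on x y g -> (forall t, x < t < y -> f t = g t) ->
  integ x y f = integ x y g.
Proof.
move=> cg e.
have mg : measurable_fun `]x, y[ g.
  apply/measurable_EFinP; apply: (@measurable_int _ _ _ lebesgue_measure).
  apply: (integrableS _ _ _ (cont_on_integrable cg)) => //.
  exact: subset_itv_oo_cc.
rewrite /integ /Rintegral (@eq_integral_itv_bounded _ _ _ g)//.
  apply: eq_measurable_fun mg => t.
  by rewrite inE/= in_itv/= => /e ->.
Qed.

Lemma integD x y f g : cont_on x y f -> cont_on x y g ->
  integ x y (fun t => f t + g t) = integ x y f + integ x y g.
Proof.
move=> cf cg; apply: RintegralD => //; exact: cont_on_integrable.
Qed.

Lemma integ_scale x y f c : cont_on x y f ->
  integ x y (fun t => c * f t) = c * integ x y f.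
Proof. by move=> cf; apply: RintegralZl => //; exact: cont_on_integrable. Qed.

End Integ.

(** * The dot product *)

Section DotProduct.
Context {R : realType} (n : nat).
Implicit Types u v w : 'rV[R]_n.

Lemma dotvC u v : dotv u v = dotv v u.
Proof. by rewrite !dotvE; apply: eq_bigr => j _; rewrite mulrC. Qed.

Lemma dotvDl u v w : dotv (u + v) w = dotv u w + dotv v w.
Proof. by rewrite /dotv mulmxDl mxE. Qed.

Lemma dotvDr u v w : dotv w (u + v) = dotv w u + dotv w v.
Proof. by rewrite dotvC dotvDl !(dotvC w). Qed.

Lemma dotvZl a u v : dotv (a *: u) v = a * dotv u v.
Proof. by rewrite /dotv -scalemxAl mxE. Qed.

Lemma dotvZr a u v : dotv u (a *: v) = a * dotv u v.
Proof. by rewrite dotvC dotvZl dotvC. Qed.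

Lemma dotvNl u v : dotv (- u) v = - dotv u v.
Proof. by rewrite -scaleN1r dotvZl mulN1r. Qed.

Lemma dotvNr u v : dotv u (- v) = - dotv u v.
Proof. by rewrite dotvC dotvNl dotvC. Qed.

Lemma dotv0l u : dotv 0 u = 0.
Proof. by rewrite /dotv mul0mx mxE. Qed.

Lemma dotv0r u : dotv u 0 = 0.
Proof. by rewrite dotvC dotv0l. Qed.

Lemma dotv_delta u j : dotv u (delta_mx 0 j) = u 0 j.
Proof.
rewrite dotvE (bigD1 j)//= big1 ?addr0 => [|i ij]; rewrite mxE eqxx ?eqxx ?mulr1//=.
by rewrite (negPf ij) mulr0.
Qed.

Lemma dotv_ge0 u : 0 <= dotv u u.
Proof. by rewrite dotvE sumr_ge0// => j _; rewrite -expr2 sqr_ge0. Qed.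

Lemma dotv_eq0 u : (dotv u u == 0) = (u == 0).
Proof.
apply/eqP/eqP => [|->]; last exact: dotv0l.
move/eqP; rewrite dotvE psumr_eq0 => [/allP h|j _]; last by rewrite -expr2 sqr_ge0.
apply/rowP => j; rewrite mxE; have := h j; rewrite mem_index_enum mulf_eq0 orbb.
by move=> /(_ isT)/eqP.
Qed.

End DotProduct.

Definition dotvE_lin {R : realType} n := (@dotvDl R n, @dotvDr R n, @dotvNl R n,
  @dotvNr R n, @dotvZl R n, @dotvZr R n).

(** * Differentials of the physical quantities *)

Section States.
Context {R : realType} {M : nat}.
Implicit Types (U V : state R M) (D : set (state R M)).

Lemma state_eta U : U = mk_state (density U) (momentum U) (energy U) (magnetic U).
Proof.
rewrite /mk_state /density /energy -!mx11_scalar /momentum /magnetic.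
by rewrite !hsubmxK.
Qed.

Lemma dotv_row_mx n1 n2 (a c : 'rV[R]_n1) (b d : 'rV[R]_n2) :
  dotv (row_mx a b) (row_mx c d) = dotv a c + dotv b d.
Proof. by rewrite /dotv tr_row_mx mul_row_col mxE. Qed.

Lemma dotv_mk r m e b r' m' e' b' :
  dotv (mk_state r m e b : state R M) (mk_state r' m' e' b')
  = r * r' + dotv m m' + e * e' + dotv b b'.
Proof.
have h (x y : R) : dotv (x%:M : 'rV_1) y%:M = x * y.
  by rewrite /dotv tr_scalar_mx -scalar_mxM mxE eqxx mulr1n.
by rewrite /mk_state !dotv_row_mx !h !addrA.
Qed.

Lemma dotv_mkl r m e b V :
  dotv (mk_state r m e b) V
  = r * density V + dotv m (momentum V) + e * energy V + dotv b (magnetic V).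
Proof. by rewrite {1}(state_eta V) dotv_mk. Qed.

Lemma magneticZ a U : magnetic (a *: U) = a *: magnetic U.
Proof. by apply/rowP => j; rewrite !mxE. Qed.

Lemma C1_density D : C1 D (@density R M) (fun _ => density).
Proof.
by apply: C1_eq (C1_coord (lshift _ (0 : 'I_1))) _ _ => *; rewrite /density mxE.
Qed.

Lemma C1v_momentum D : C1v D (@momentum R M) (fun _ => momentum).
Proof.
move=> j; apply: C1_eq (C1_coord (rshift _ (lshift _ j))) _ _ => *;
  by rewrite /momentum !mxE.
Qed.

Lemma C1_energy D : C1 D (@energy R M) (fun _ => energy).
Proof.
apply: C1_eq (C1_coord (rshift _ (rshift _ (lshift _ (0 : 'I_1))))) _ _ => *;
  by rewrite /energy !mxE.
Qed.

Lemma C1v_magnetic D : C1v D (@magnetic R M) (fun _ => magnetic).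
Proof.
move=> j; apply: C1_eq (C1_coord (rshift _ (rshift _ (rshift _ j)))) _ _ => *;
  by rewrite /magnetic !mxE.
Qed.

Arguments C1_density {D}.
Arguments C1v_momentum {D}.
Arguments C1_energy {D}.
Arguments C1v_magnetic {D}.

Lemma C1_sub n (D D' : set 'rV[R]_n) f df : D' `<=` D -> C1 D f df -> C1 D' f df.
Proof. by move=> s h U /s /h. Qed.

Lemma C1v_mk_state D r m e b dr dm de db :
  C1 D r dr -> C1v D m dm -> C1 D e de -> C1v D b db ->
  C1v D (fun U => mk_state (r U) (m U) (e U) (b U) : state R M)
    (fun U v => mk_state (dr U v) (dm U v) (de U v) (db U v)).
Proof.
move=> hr hm he hb j; case: (split_ordP j) => [k|k] ->{j}.
  by apply: C1_eq hr _ _ => *; rewrite /mk_state row_mxEl mxE ord1 eqxx mulr1n.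
case: (split_ordP k) => [l|l] ->{k}.
  by apply: C1_eq (hm l) _ _ => *; rewrite /mk_state row_mxEr row_mxEl.
case: (split_ordP l) => [k|k] ->{l}.
  by apply: C1_eq he _ _ => *; rewrite /mk_state !row_mxEr row_mxEl mxE ord1 eqxx mulr1n.
by apply: C1_eq (hb k) _ _ => *; rewrite /mk_state !row_mxEr.
Qed.

Definition pos_density : set (state R M) := [set U | 0 < density U].

(** Simplifying a differential requires nonzero denominators, so the two formulas agree only on [D];
    continuity survives because [D] is open. *)
Lemma C1_eq_in n (D : set 'rV[R]_n) f df f' df' : open D -> C1 D f df ->
  (forall X, f X = f' X) -> (forall X v, D X -> df X v = df' X v) -> C1 D f' df'.
Proof.
move=> oD hf e e'; have <- : f = f' by apply/funext.
move=> U DU; have [[dU eU] cU] := hf _ DU; split.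
  by apply: DiffDef => //; rewrite eU; apply/funext => v; rewrite e'.
move=> v; have cv : df ^~ v @ U --> df U v := cU v.
suff : df' ^~ v @ U --> df' U v by [].
rewrite -e'//; apply: cvg_trans cv.
have nD : \forall X \near U, D X by apply: open_nbhs_nbhs.
apply: (@near_eq_cvg _ _ (nbhs U)).
by apply: filterS nD => X DX; rewrite e'.
Qed.

Lemma open_pos_density : open pos_density.
Proof.
rewrite openE => U r0; have cr := C1_continuous (C1_density (D := setT)) (I : setT U).
exact: cvgr_gt cr _ r0.
Qed.

Definition dvelocity U V : 'rV[R]_M.+1 :=
  (density U)^-1 *: (momentum V - density V *: velocity U).

Lemma C1v_velocity : C1v pos_density (@velocity R M) dvelocity.
Proof.
have h0 U : pos_density U -> density U != 0.
  by rewrite /pos_density/= => /gt_eqF ->.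
have h := C1V C1_density h0.
apply: C1v_eq (C1vZ h C1v_momentum) _ _ => // U V.
apply/rowP => j; rewrite /dvelocity /velocity.
move: (momentum U) (momentum V) (density U) (density V) => m m' r r'.
(* [C1v_eq] asks for the identity at every state; at zero density both sides vanish since the
   inverse of 0 is 0. *)
by rewrite !mxE; have [->|r0] := eqVneq r 0; [rewrite expr0n/= !invr0; ring|field].
Qed.

(** The kinetic energy is |m|^2 / (2 rho), whose differential is u . dm - |u|^2 / 2 drho; this form
    contains no differential of the velocity. *)
Definition dpressure U V : R :=
  (gamma - 1) * (energy V - dotv (velocity U) (momentum V)
    + dotv (velocity U) (velocity U) / 2%:R * density V
    - dotv (magnetic U) (magnetic V)).

Lemma C1_pressure : C1 pos_density (@pressure R M) dpressure.
Proof.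
have hu := C1v_velocity; have hB := C1v_magnetic (D := pos_density).
have huu := C1_dotv hu hu; have hBB := C1_dotv hB hB.
have h2 := C1_cst (D := pos_density) (2%:R^-1 : R).
have hg := C1_cst (D := pos_density) (gamma - 1 : R).
apply: C1_eq_in open_pos_density (C1M hg (C1D (C1D C1_energy
  (C1N (C1M (C1M C1_density huu) h2))) (C1N (C1M hBB h2)))) _ _ => [//|U V].
rewrite /pos_density/= /dpressure => /gt_eqF/negbT r0.
rewrite [in LHS]/dvelocity !dotvE_lin.
rewrite ![dotv (momentum V) _]dotvC ![dotv (magnetic V) _]dotvC.
by field.
Qed.

Lemma energyE U : energy U = pressure U / (gamma - 1)
  + density U * dotv (velocity U) (velocity U) / 2%:R
  + dotv (magnetic U) (magnetic U) / 2%:R.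
Proof. by rewrite /pressure /gamma; field. Qed.

Lemma open_G : open (@G R M).
Proof.
rewrite openE => U [r0 p0]; have cp := C1_continuous C1_pressure r0.
have cr := C1_continuous (C1_density (D := pos_density)) r0.
apply: filterI; first exact: cvgr_gt cr _ r0.
exact: cvgr_gt cp _ p0.
Qed.

Lemma G_pos_density : G `<=` pos_density.
Proof. by move=> U []. Qed.

End States.

(** * Entropy gradient, Hessian and entropy flux *)

Section EntropyCalculus.
Context {R : realType} {M : nat}.
Implicit Types (U V W : state R M).
Local Notation G := (@G R M).

Definition inv_temp U : R := density U / pressure U.

Definition dinv_temp U V : R :=
  density V / pressure U - density U * dpressure U V / pressure U ^+ 2.

Lemma G_neq0 U : G U -> density U != 0 /\ pressure U != 0.
Proof. by case=> r p; rewrite !gt_eqF. Qed.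

Lemma C1_density_G : C1 G (@density R M) (fun _ => density).
Proof. exact: C1_density. Qed.

Lemma C1_pressure_G : C1 G (@pressure R M) dpressure.
Proof. exact: C1_sub G_pos_density C1_pressure. Qed.

Lemma C1v_velocity_G : C1v G (@velocity R M) dvelocity.
Proof. by move=> j; exact: C1_sub G_pos_density (C1v_velocity j). Qed.

Lemma C1_inv_temp : C1 G inv_temp dinv_temp.
Proof.
have h0 U : G U -> pressure U != 0 by case/G_neq0.
apply: C1_eq_in open_G (C1M C1_density_G (C1V C1_pressure_G h0)) _ _ => // U V.
by move=> /h0 p0; rewrite /dinv_temp; field.
Qed.

Definition dspec_entropy U V : R :=
  dpressure U V / pressure U - gamma * density V / density U.

Lemma spec_entropyE U : G U ->
  spec_entropy U = ln (pressure U) - gamma * ln (density U).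
Proof.
by case=> r p; rewrite /spec_entropy lnM ?posrE ?powR_gt0// ln_powR mulNr.
Qed.

Lemma C1_spec_entropy : C1 G spec_entropy dspec_entropy.
Proof.
have r0 U : G U -> 0 < density U by case.
have p0 U : G U -> 0 < pressure U by case.
have h := C1D (C1_ln C1_pressure_G p0)
  (C1M (C1_cst (D := G) (- gamma)) (C1_ln C1_density_G r0)).
have h' : C1 G (fun U => ln (pressure U) + - gamma * ln (density U)) dspec_entropy.
  apply: C1_eq h _ _ => // U V; rewrite /dspec_entropy; ring.
by apply: (C1_eq_on open_G h') => U GU; rewrite spec_entropyE// mulNr.
Qed.

Definition entropy_var0 U : R := (gamma - spec_entropy U) / (gamma - 1)
  - inv_temp U * dotv (velocity U) (velocity U) / 2%:R.

(* The gradient V of the entropy, with rho / P = 2 beta. *)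
Definition entropy_vars U : state R M :=
  mk_state (entropy_var0 U) (inv_temp U *: velocity U) (- inv_temp U)
    (inv_temp U *: magnetic U).

Lemma C1_entropy : C1 G entropy (fun U V => dotv (entropy_vars U) V).
Proof.
have h := C1M (C1M C1_density_G C1_spec_entropy)
  (C1_cst (D := G) (- (gamma - 1)^-1)).
apply: C1_eq_in open_G h _ _ => [U|U V /G_neq0[r0 p0]].
  by rewrite /entropy mulrN mulNr.
rewrite /entropy_vars dotv_mkl /dspec_entropy /dpressure /entropy_var0 /inv_temp.
move: (velocity U) (spec_entropy U) => u s; rewrite !dotvE_lin /gamma.
move: (dotv _ (momentum V)) (dotv u u) (dotv _ (magnetic V)).
move: (density U) (pressure U) r0 p0 (density V) (energy V).
by move=> r p r0 p0 *; field; rewrite r0 p0.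
Qed.

Lemma grad_entropy U : G U -> grad entropy U = entropy_vars U.
Proof.
by move=> GU; apply/rowP => j; rewrite (grad_coord _ C1_entropy GU) dotv_delta.
Qed.

Definition dentropy_var0 U V : R := - dspec_entropy U V / (gamma - 1)
  - dinv_temp U V * dotv (velocity U) (velocity U) / 2%:R
  - inv_temp U * dotv (velocity U) (dvelocity U V).

(** The Hessian of the entropy at [U] applied to [V]. *)
Definition dentropy_vars U V : state R M :=
  mk_state (dentropy_var0 U V)
    (inv_temp U *: dvelocity U V + dinv_temp U V *: velocity U)
    (- dinv_temp U V)
    (inv_temp U *: magnetic V + dinv_temp U V *: magnetic U).

Lemma C1v_entropy_vars : C1v G entropy_vars dentropy_vars.
Proof.
have hu := C1v_velocity_G; have hq := C1_inv_temp.
apply: C1v_mk_state.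
- have h := C1D (C1M (C1D (C1_cst (D := G) gamma) (C1N C1_spec_entropy))
    (C1_cst (gamma - 1)^-1)) (C1M (C1M hq (C1_dotv hu hu)) (C1_cst (- 2%:R^-1))).
  apply: C1_eq h _ _ => [U|U V].
    by rewrite /entropy_var0 mulrN.
  rewrite /dentropy_var0 (dotvC (dvelocity U V)).
  by rewrite /gamma; field.
- exact: C1vZ.
- exact: C1N.
- have hB := C1v_magnetic (D := G); exact: C1vZ hq hB.
Qed.

Lemma C1v_grad_entropy : C1v G (grad entropy) dentropy_vars.
Proof.
move=> j; apply: (C1_eq_on open_G (C1v_entropy_vars j)) => U GU.
by rewrite grad_entropy.
Qed.

(** A direct calculation on the explicit formula. The symmetry is used twice: to integrate the
    Hessian along a segment and to apply the Rayleigh quotient. *)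
Lemma dentropy_vars_sym U V W : G U ->
  dotv W (dentropy_vars U V) = dotv V (dentropy_vars U W).
Proof.
move=> /G_neq0[r0 p0]; rewrite ![dotv _ (dentropy_vars _ _)]dotvC.
rewrite !dotv_mkl /dentropy_var0 /dinv_temp /inv_temp /dspec_entropy /dvelocity.
rewrite /dpressure; move: (velocity U) => u; rewrite !dotvE_lin.
rewrite (dotvC (momentum V) (momentum W)) (dotvC (magnetic V) (magnetic W)) /gamma.
move: (dotv u _) (dotv u _) (dotv u _) (dotv (momentum W) _).
move: (dotv (magnetic U) _) (dotv (magnetic U) _) (dotv (magnetic W) _).
move: (density U) (pressure U) r0 p0 (density V) (energy V) (density W) (energy W).
by move=> r p r0 p0 *; field; rewrite r0 p0.
Qed.

End EntropyCalculus.

(** * Compatibility of flux, entropy flux and source *)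

Section EntropicSystems.
Context {R : realType} {M : nat}.
Implicit Types (U V W : state R M) (L : system R M).
Local Notation G := (@G R M).

Definition entropic L := exists dF dE dS,
  [/\ C1v G (flux L) dF, C1 G (eflux L) dE, C1v G (source L) dS &
      forall U V, G U -> dE U V = dotv (entropy_vars U) (dF U V)
        + dotv (entropy_vars U) (source L U) * dotv dmag_x V].

Lemma reversed_entropic L : entropic L -> entropic (reversed L).
Proof.
move=> [dF [dE [dS [hF hE hS h]]]].
exists (fun U V => - dF U V), (fun U V => - dE U V), (fun U V => - dS U V).
split; [exact: C1vN|exact: C1N|exact: C1vN|move=> U V GU /=].
by rewrite h// !dotvNr opprD mulNr.
Qed.

Lemma dmag_xE V : dotv dmag_x V = mag_x V.
Proof.
by rewrite /dmag_x dotv_mkl !mul0r dotv0l !add0r dotvC dotv_delta.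
Qed.

Definition dtotal_pressure U V : R :=
  dpressure U V + dotv (magnetic U) (magnetic V).

Lemma C1_total_pressure : C1 G total_pressure dtotal_pressure.
Proof.
have hB := C1v_magnetic (D := G).
have h := C1D C1_pressure_G (C1M (C1_dotv hB hB) (C1_cst (D := G) (2%:R^-1 : R))).
apply: C1_eq h _ _ => // U V; rewrite /dtotal_pressure.
by rewrite (dotvC (magnetic V)); field.
Qed.

Definition dvel_x U V : R := dvelocity U V 0 0.

Definition dmhd_flux U V : state R M :=
  let u := velocity U in let B := magnetic U in
  let du := dvelocity U V in let dB := magnetic V in
  let r := density U in let ux := vel_x U in let Bx := mag_x U in
  let dr := density V in let dux := dvel_x U V in let dBx := mag_x V in
  mk_state
    (r * dux + ux * dr)
    (((r * ux) *: du + (r * dux + ux * dr) *: u)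
     + dtotal_pressure U V *: delta_mx 0 0 - (Bx *: dB + dBx *: B))
    ((ux * (energy V + dtotal_pressure U V) + (energy U + total_pressure U) * dux)
     - (Bx * (dotv u dB + dotv du B) + dotv u B * dBx))
    ((ux *: dB + dux *: B) - (Bx *: du + dBx *: u)).

Lemma C1v_mhd_flux : C1v G mhd_flux dmhd_flux.
Proof.
have hr := C1_density_G (R := R) (M := M); have hu := C1v_velocity_G (R := R) (M := M).
have hux : C1 G vel_x dvel_x by exact: hu.
have hB := C1v_magnetic (D := G).
have hBx : C1 G mag_x (fun _ V => mag_x V) by exact: hB.
have hm := C1M hr hux; have hP := C1_total_pressure.
have he : C1v G (fun U => total_pressure U *: delta_mx 0 0 : 'rV[R]_M.+1)
    (fun U V => dtotal_pressure U V *: delta_mx 0 0).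
  have h := C1vZ hP (C1v_cst (D := G) (delta_mx 0 0 : 'rV[R]_M.+1)).
  by apply: C1v_eq h _ _ => // U V; rewrite scaler0 add0r.
apply: C1v_mk_state.
- exact: hm.
- exact: C1vD (C1vD (C1vZ hm hu) he) (C1vN (C1vZ hBx hB)).
- have hE := C1_energy (D := G).
  exact: C1D (C1M hux (C1D hE hP)) (C1N (C1M hBx (C1_dotv hu hB))).
- exact: C1vD (C1vZ hux hB) (C1vN (C1vZ hBx hu)).
Qed.

Definition dmhd_eflux U V : R :=
  - (density U * spec_entropy U * dvel_x U V
     + vel_x U * (density U * dspec_entropy U V + spec_entropy U * density V))
  / (gamma - 1).

Lemma C1_mhd_eflux : C1 G mhd_eflux dmhd_eflux.
Proof.
have hu := C1v_velocity_G (R := R) (M := M).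
have hux : C1 G vel_x dvel_x by exact: hu.
have h := C1M (C1N (C1M (C1M C1_density_G C1_spec_entropy) hux))
  (C1_cst (D := G) ((gamma - 1)^-1 : R)).
by apply: C1_eq h _ _ => // U V; rewrite mulr0 add0r mulrC.
Qed.

Definition dmhd_source U V : state R M :=
  mk_state 0 (magnetic V)
    (dotv (velocity U) (magnetic V) + dotv (dvelocity U V) (magnetic U))
    (dvelocity U V).

Lemma C1v_mhd_source : C1v G mhd_source dmhd_source.
Proof.
have hu := C1v_velocity_G (R := R) (M := M); have hB := C1v_magnetic (D := G).
apply: C1v_mk_state; [exact: C1_cst|exact: hB|exact: C1_dotv|exact: hu].
Qed.

(** Contracting the flux differential with V leaves the residue - (rho / P) (u . B) dB_x besides the
    entropy flux differential; since V . S = (rho / P) (u . B), the source term cancels it. *)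
Lemma mhd_entropic : entropic (mhd R M).
Proof.
exists dmhd_flux, dmhd_eflux, dmhd_source; split.
- exact: C1v_mhd_flux.
- exact: C1_mhd_eflux.
- exact: C1v_mhd_source.
move=> U V /G_neq0[r0 p0] /=; rewrite dmag_xE /entropy_vars /dmhd_flux /mhd_source !dotv_mk.
rewrite /dmhd_eflux /dtotal_pressure /dspec_entropy.
(* The flux is differentiated through the velocity, so the pressure differential is rewritten with
   [dvelocity]. *)
have dp : dpressure U V = (gamma - 1) * (energy V - density U * dotv (velocity U) (dvelocity U V)
    - dotv (velocity U) (velocity U) / 2%:R * density V - dotv (magnetic U) (magnetic V)).
  rewrite /dpressure /dvelocity; move: (velocity U) => u; rewrite !dotvE_lin.
  by field.
rewrite /entropy_var0 /inv_temp /total_pressure (energyE U).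
(* Passing to the variables (rho, u, P, B): with the energy differential eliminated, what remains is
   a rational identity in scalars and dot products. *)
have -> : energy V = dpressure U V / (gamma - 1) + density U * dotv (velocity U) (dvelocity U V)
    + dotv (velocity U) (velocity U) / 2%:R * density V + dotv (magnetic U) (magnetic V).
  by rewrite dp /gamma; field.
have ux0 : velocity U 0 0 = vel_x U by [].
clear dp; move: (dpressure U V) (vel_x U) (mag_x U) (dvel_x U V) (mag_x V) ux0.
move: (velocity U) (magnetic U) (dvelocity U V) (magnetic V) => u B du dB.
move=> dP ux Bx dux dBx ux0.
rewrite !dotvE_lin !dotv_delta ux0 (dotvC B u) (dotvC B du) /gamma.
move: (dotv u u) (dotv u B) (dotv u du) (dotv u dB) (dotv du B) (dotv B B) (dotv B dB).
move: (spec_entropy U) (density U) (pressure U) r0 p0 (density V).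
by move=> s r p r0 p0 *; field; rewrite r0 p0.
Qed.

End EntropicSystems.

(** * Relative entropy and convexity *)

Section EntropyConvexity.
Context {R : realType} {M : nat}.
Implicit Types (U V a b c : state R M).
Local Notation G := (@G R M).

Lemma ln_lt_subr1 (t : R) : 0 < t -> t != 1 -> ln t < t - 1.
Proof.
move=> t0 t1; rewrite ltrBrDl -[ltRHS]lnK ?posrE//.
by apply: expR_gt1Dx; rewrite ln_eq0.
Qed.

Lemma ln_le_subr1 (t : R) : 0 < t -> ln t <= t - 1.
Proof.
by move=> t0; have [->|t1] := eqVneq t 1; [rewrite ln1 subrr|exact/ltW/ln_lt_subr1].
Qed.

(** The Bregman divergence of the entropy. It is the denominator of both entropy-stable speeds
    ([hess_integral1]). *)
Definition relative_entropy b c : R :=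
  entropy c - entropy b - dotv (entropy_vars b) (c - b).

(* With x = rho' / rho and z = P' rho / (P rho'), so that everything but the
   kinetic and magnetic squares is controlled by t - 1 - ln t >= 0. *)
Lemma relative_entropyE b c : G b -> G c ->
  let x := density c / density b in
  let z := pressure c / pressure b / x in
  relative_entropy b c =
    inv_temp b / 2%:R * (density c * dotv (velocity c - velocity b) (velocity c - velocity b)
      + dotv (magnetic c - magnetic b) (magnetic c - magnetic b))
    + density b / (gamma - 1) * (x * (z - 1 - ln z))
    + density b * (x * (x^-1 - 1 - ln x^-1)).
Proof.
move=> Gb Gc x z; have [[r0 p0] [r0' p0']] := (Gb, Gc).
have [/eqP/eqP rn pn] := G_neq0 Gb; have [rn' pn'] := G_neq0 Gc.
have x0 : 0 < x by rewrite divr_gt0.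
have lx : ln x = ln (density c) - ln (density b) by rewrite ln_div.
have -> : ln x^-1 = ln (density b) - ln (density c) by rewrite lnV// lx opprB.
have -> : ln z = ln (pressure c) - ln (pressure b) - (ln (density c) - ln (density b)).
  by rewrite ln_div ?posrE ?divr_gt0// ln_div// lx.
rewrite /relative_entropy dotvDr dotvNr /entropy !spec_entropyE// /entropy_vars !dotv_mkl.
rewrite /entropy_var0 spec_entropyE// /inv_temp !energyE.
have mE U : density U != 0 -> momentum U = density U *: velocity U.
  by move=> h; rewrite /velocity scalerA divff ?scale1r.
rewrite !mE// {lx}/z /x.
move: (velocity b) (velocity c) (magnetic b) (magnetic c) => u u' B B'.
rewrite !dotvE_lin (dotvC u' u) (dotvC B' B) /gamma.
move: (dotv u u) (dotv u u') (dotv u' u') (dotv B B) (dotv B B') (dotv B' B').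
move: (ln _) (ln _) (ln _) (ln _) => *.
move: (density b) (density c) (pressure b) (pressure c) rn rn' pn pn'.
by move=> r r' p p' rn rn' pn pn'; field; rewrite rn rn' pn.
Qed.

(** The three terms of [relative_entropyE] are nonnegative. The last vanishes only for equal
    densities, the middle one then only for equal pressures, and the first only for equal velocities
    and magnetic fields; together these determine the state. *)
Lemma relative_entropy_gt0 b c : G b -> G c -> c != b -> 0 < relative_entropy b c.
Proof.
move=> Gb Gc cb; have [[r0 p0] [r0' p0']] := (Gb, Gc).
rewrite relative_entropyE//; set x := density c / density b.
set z := pressure c / pressure b / x.
have x0 : 0 < x by rewrite divr_gt0.
have z0 : 0 < z by rewrite divr_gt0// divr_gt0.
have g0 : 0 < gamma - 1 :> R by rewrite /gamma; lra.
have q0 : 0 < inv_temp b / 2%:R by rewrite divr_gt0// divr_gt0.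
have n0 (t : R) : 0 < t -> 0 <= t - 1 - ln t.
  by move=> /ln_le_subr1; rewrite subr_ge0.
have n1 (t : R) : 0 < t -> t != 1 -> 0 < t - 1 - ln t.
  by move=> t0 /(ln_lt_subr1 t0); rewrite subr_gt0.
set T1 := inv_temp b / 2%:R * _; set T2 := density b / _ * _; set T3 := density b * _.
have T1_ge0 : 0 <= T1.
  by rewrite mulr_ge0 ?(ltW q0)// addr_ge0 ?mulr_ge0 ?dotv_ge0// ltW.
have T2_ge0 : 0 <= T2.
  by rewrite mulr_ge0 ?divr_ge0 ?(ltW g0) ?(ltW r0)// mulr_ge0 ?(ltW x0)// n0.
have T3_ge0 : 0 <= T3.
  by rewrite mulr_ge0 ?(ltW r0)// mulr_ge0 ?(ltW x0)// n0 ?invr_gt0.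
have [x1|x1] := eqVneq x 1; last first.
  apply: ltr_wpDl; first exact: addr_ge0.
  by rewrite mulr_gt0// mulr_gt0// n1 ?invr_gt0// invr_eq1.
have [z1|z1] := eqVneq z 1; last first.
  apply: ltr_pwDl => //; apply: ltr_wpDl => //.
  by rewrite mulr_gt0 ?divr_gt0// mulr_gt0// n1.
have rr : density c = density b by rewrite -[RHS]mul1r -x1 /x divfK ?gt_eqF.
have pp : pressure c = pressure b.
  have e : pressure c / pressure b = 1 by rewrite -[RHS]z1 /z x1 divr1.
  by rewrite -[RHS]mul1r -e divfK ?gt_eqF.
apply: ltr_pwDl => //; apply: ltr_pwDl => //; rewrite mulr_gt0// lt0r.
rewrite addr_ge0 ?mulr_ge0 ?dotv_ge0 ?(ltW r0')// andbT.
apply: contra cb; rewrite paddr_eq0 ?mulr_ge0 ?dotv_ge0 ?(ltW r0')// mulf_eq0 (gt_eqF r0') /=.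
rewrite !dotv_eq0 !subr_eq0 => /andP[/eqP uu /eqP BB].
have mE U : 0 < density U -> momentum U = density U *: velocity U.
  by move=> h; rewrite /velocity scalerA divff ?scale1r ?gt_eqF.
by rewrite (state_eta c) (state_eta b) !mE// !energyE rr pp uu BB.
Qed.

Lemma dotv_sumZr n (I : finType) (w : I -> R) (c : I -> 'rV[R]_n) v :
  dotv v (\sum_i w i *: c i) = \sum_i w i * dotv v (c i).
Proof.
have -> : dotv v (\sum_i w i *: c i) = \sum_i dotv v (w i *: c i).
  by apply: (big_morph (dotv v)) => [x y|]; rewrite ?dotvDr ?dotv0r.
by apply: eq_bigr => i _; rewrite dotvZr.
Qed.

Section ConvexCombination.
Context (I : finType) (w : I -> R) (w0 : forall i, 0 <= w i) (w1 : \sum_i w i = 1).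

(** Here and below nothing is asked at indices of zero weight, because a stage with [alpha l = 0] is
    not subject to the CFL condition. *)
Lemma wsum_gt0 (f : I -> R) : (forall i, w i != 0 -> 0 < f i) ->
  0 < \sum_i w i * f i.
Proof.
move=> f0; have h i : 0 <= w i * f i.
  have [->|/[dup] wi /f0/ltW fi] := eqVneq (w i) 0; first by rewrite mul0r.
  exact: mulr_ge0.
rewrite lt0r sumr_ge0// andbT; apply/negP; rewrite psumr_eq0// => /allP h0.
have /eqP := oner_neq0 R; apply; rewrite -w1 big1// => i _.
apply/eqP/negPn/negP => wi; have := h0 i (mem_index_enum i).
by rewrite /= mulf_eq0 (negPf wi) (gt_eqF (f0 _ wi)).
Qed.

Context (c : I -> state R M) (cG : forall i, w i != 0 -> G (c i)).

Lemma G_convex : G (\sum_i w i *: c i).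
Proof.
set U := \sum_i _.
have r0 : 0 < density U.
  have dE V : density V = dotv (mk_state 1 0 0 0) V.
    by rewrite dotv_mkl !dotv0l mul0r mul1r !addr0.
  by rewrite dE dotv_sumZr; apply: wsum_gt0 => i /cG[]; rewrite -dE.
split=> //.
pose l := mk_state (dotv (velocity U) (velocity U) / 2%:R) (- velocity U) 1 (- magnetic U) : state R M.
pose k := dotv (magnetic U) (magnetic U) / 2%:R.
have g0 : 0 < gamma - 1 :> R by rewrite /gamma; lra.
have mE V : 0 < density V -> momentum V = density V *: velocity V.
  by move=> h; rewrite /velocity scalerA divff ?scale1r ?gt_eqF.
(* the pressure is an infimum of affine functions, attained at the velocity and
   magnetic field of the state *)
have hl V : 0 < density V -> pressure V / (gamma - 1) = dotv l V + k
    - (density V * dotv (velocity V - velocity U) (velocity V - velocity U)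
       + dotv (magnetic V - magnetic U) (magnetic V - magnetic U)) / 2%:R.
  move=> rV; rewrite /l /k dotv_mkl mE// energyE.
  move: (velocity V) (velocity U) (magnetic V) (magnetic U) => u v B b.
  by rewrite !dotvE_lin (dotvC v u) (dotvC b B); field; rewrite gt_eqF.
have : 0 < pressure U / (gamma - 1); last by rewrite pmulr_lgt0// invr_gt0.
rewrite hl// !subrr !dotv0l mulr0 addr0 mul0r subr0 {1}/U dotv_sumZr.
have -> : k = \sum_i w i * k by rewrite -mulr_suml w1 mul1r.
rewrite -big_split /=; under eq_bigr do rewrite -mulrDr.
apply: wsum_gt0 => i /cG[ri pi]; apply: (@lt_le_trans _ _ (pressure (c i) / (gamma - 1))).
  by rewrite divr_gt0.
by rewrite (hl _ ri) lerBlDr lerDl divr_ge0// addr_ge0 ?mulr_ge0 ?dotv_ge0// ltW.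
Qed.

(** The entropy lies above its tangent plane at the barycentre, because the relative entropy is
    nonnegative; the linear terms average to zero. *)
Lemma entropy_jensen : entropy (\sum_i w i *: c i) <= \sum_i w i * entropy (c i).
Proof.
have GU := G_convex; move: GU; set U := \sum_i _ => GU.
have h i : w i * (entropy U + dotv (entropy_vars U) (c i - U)) <= w i * entropy (c i).
  have [->|wi] := eqVneq (w i) 0; first by rewrite !mul0r.
  apply: ler_wpM2l => //; have [->|ci] := eqVneq (c i) U.
    by rewrite subrr dotv0r addr0.
  have := relative_entropy_gt0 GU (cG wi) ci.
  by rewrite /relative_entropy -addrA -opprD subr_gt0 => /ltW.
apply: le_trans (ler_sum _ (fun i _ => h i)).
under eq_bigr do rewrite dotvDr dotvNr addrA mulrBr mulrDr.
rewrite sumrB big_split /= -!mulr_suml w1 !mul1r -dotv_sumZr -/U.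
by rewrite addrK.
Qed.

End ConvexCombination.

Lemma segment_sum n (a b : 'rV[R]_n) (t : R) :
  a + t *: (b - a) = \sum_(i : bool) (if i then t else 1 - t) *: (if i then b else a).
Proof. by rewrite big_bool /= scalerBl scale1r scalerBr; rewrite addrCA. Qed.

Lemma G_segment a b t : G a -> G b -> 0 <= t <= 1 -> G (a + t *: (b - a)).
Proof.
move=> Ga Gb /andP[t0 t1]; rewrite segment_sum; apply: G_convex.
- by case=> //; rewrite subr_ge0.
- by rewrite big_bool /= addrC subrK.
- by case.
Qed.

Lemma entropy_convex a b t : G a -> G b -> 0 <= t <= 1 ->
  entropy (a + t *: (b - a)) <= entropy a + t * (entropy b - entropy a).
Proof.
move=> Ga Gb /andP[t0 t1]; rewrite segment_sum.
apply: (le_trans (entropy_jensen _ _ _)).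
- by case=> //; rewrite subr_ge0.
- by rewrite big_bool /= addrC subrK.
- by case.
by rewrite big_bool /= mulrBl mul1r mulrBr addrCA.
Qed.

End EntropyConvexity.

(** * Entropy stable wave speeds *)

Section Rayleigh.
Context {R : realType} (n : nat) (A : 'M[R]_n.+1).
Implicit Types u v w : 'rV[R]_n.+1.

Definition quad v : R := dotv v (v *m A).

Lemma dotv_mulmx u v : dotv u (v *m A) = dotv (u *m A^T) v.
Proof. by rewrite /dotv trmx_mul mulmxA. Qed.

Lemma C1_dotv_id : C1 setT (fun v : 'rV[R]_n.+1 => dotv v v)
  (fun u v => dotv u v + dotv v u).
Proof.
have h : C1v setT (fun v : 'rV[R]_n.+1 => v) (fun _ v => v) := C1_coord (D := setT).
exact: C1_dotv.
Qed.

Lemma continuous_quad : continuous quad.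
Proof.
have h : C1v setT (fun v : 'rV[R]_n.+1 => v) (fun _ v => v) := C1_coord (D := setT).
have hA : C1v setT (fun v => v *m A) (fun _ v => v *m A).
  move=> j; have hs := C1_sum (fun k : 'I_n.+1 => C1M (h k) (C1_cst (A k j))).
  by apply: C1_eq hs _ _ => *; rewrite mxE//; apply: eq_bigr => k _;
    rewrite mulr0 add0r mulrC.
by move=> v; apply: (C1_continuous (C1_dotv h hA)).
Qed.

Hypothesis symA : A^T = A.

(** A maximizer [c] of the form on the compact unit sphere is an eigenvector. With the residual w =
    c A - l c, maximality along c + t w gives 2 t |w|^2 + t^2 k <= 0 for all t, which fails for
    small t > 0 unless w = 0. *)
Lemma exists_max_quad : exists2 l, eigenvalue A l & forall v, quad v <= l * dotv v v.
Proof.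
pose S : set 'rV[R]_n.+1 := [set v | dotv v v = 1].
have cS : compact S.
  apply: (subclosed_compact _ (rV_compact (fun=> @segment_compact R (-1) 1))).
    have -> : S = (fun v => dotv v v) @^-1` [set 1] by [].
    apply: closed_comp; last exact: closed_eq.
    by move=> v _; exact: (C1_continuous C1_dotv_id).
  move=> v Sv i /=; rewrite in_itv /= -ler_norml -(@expr_le1 _ 2)//.
  rewrite -Sv dotvE (bigD1 i)//= -expr2 real_normK ?num_real// lerDl.
  by apply: sumr_ge0 => j _; rewrite -expr2 sqr_ge0.
have S0 : S !=set0.
  by exists (delta_mx 0 0); rewrite /S/= dotv_delta mxE !eqxx.
have cq : {within S, continuous quad} by apply: continuous_subspaceT; exact: continuous_quad.
have [c /set_mem Sc hmax] := EVT_max_rV S0 cS cq.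
pose l := quad c.
have hl v : quad v <= l * dotv v v.
  have [->|v0] := eqVneq v 0; first by rewrite /quad !dotv0l mulr0.
  have p : 0 < dotv v v by rewrite lt0r dotv_eq0 v0 dotv_ge0.
  have Sv : S ((Num.sqrt (dotv v v))^-1 *: v).
    rewrite /S/= !dotvE_lin mulrA -invfM -expr2 sqr_sqrtr ?mulVf ?gt_eqF//.
    exact: ltW.
  have := hmax _ (mem_set Sv).
  rewrite /quad -scalemxAl !dotvE_lin mulrA -invfM -expr2 sqr_sqrtr ?(ltW p)//.
  by rewrite ler_pdivrMl// mulrC.
have cc : dotv c c = 1 by [].
exists l => //; apply/eigenvalueP; exists c; last first.
  by apply/eqP => c0; have /eqP := oner_neq0 R; apply; rewrite -cc c0 dotv0l.
have [w wE] : exists w, w = c *m A - l *: c by exists (c *m A - l *: c).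
apply/eqP; rewrite -subr_eq0 -wE -dotv_eq0.
apply/negPn/negP => w0; have wp : 0 < dotv w w by rewrite lt0r w0 dotv_ge0.
pose b := dotv w w; pose k := quad w - l * b.
have key t : 2%:R * t * b + t ^+ 2 * k <= 0.
  have := hl (c + t *: w); rewrite -subr_le0.
  suff -> : quad (c + t *: w) - l * dotv (c + t *: w) (c + t *: w)
      = 2%:R * t * b + t ^+ 2 * k by [].
  rewrite /k /quad mulmxDl -scalemxAl !dotvE_lin (dotv_mulmx c w) symA.
  have bE : b = dotv w (c *m A) - l * dotv w c.
    by rewrite /b {2}wE dotvDr dotvNr dotvZr.
  rewrite (dotvC (c *m A) w) (dotvC c w) bE; rewrite cc.
  have -> : dotv c (c *m A) = l by [].
  have <- : b = dotv w w by [].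
  rewrite bE; ring.
(* Since K > |k|, one has 2 K + k > 0, and t = b / K is small enough to contradict [key]. *)
pose K := `|k| + 1; have K0 : 0 < K by rewrite /K ltr_wpDl.
have := key (b / K); apply/negP; rewrite -ltNge.
have -> : 2%:R * (b / K) * b + (b / K) ^+ 2 * k = b ^+ 2 / K ^+ 2 * (2%:R * K + k).
  by field; rewrite gt_eqF.
rewrite mulr_gt0 ?divr_gt0 ?exprn_gt0//.
have := normr_ge0 k; have := ler_norm (- k); rewrite normrN /K.
lra.
Qed.

(** The [l] of [exists_max_quad] is an eigenvalue, and testing its bound on eigenvectors shows that
    it dominates all others; so the supremum is taken over a bounded set containing [l]. *)
Lemma quad_le_sigma_max v : quad v <= sigma_max A * dotv v v.
Proof.
have [l el hl] := exists_max_quad; apply: (le_trans (hl v)).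
apply: ler_wpM2r; first exact: dotv_ge0.
apply: ub_le_sup => //; exists l => m /= /eigenvalueP[u uA u0].
have p : 0 < dotv u u by rewrite lt0r dotv_eq0 u0 dotv_ge0.
by have := hl u; rewrite /quad uA dotvZr ler_pM2r.
Qed.

End Rayleigh.

(** * From the speeds to the one-sided entropy inequalities *)

Section EntropyStableSpeeds.
Context {R : realType} {M : nat}.
Implicit Types (U V a b c : state R M) (L : system R M).
Local Notation G := (@G R M).

(** By definition of the Jacobian the product differentiates V in the direction [W]; symmetry moves
    the derivative to [V], which will be the direction of the segment, so that the integrand becomes
    an exact derivative. *)
Lemma mul_hess_entropy U V W : G U ->
  (V *m hess entropy U *m W^T) 0 0 = dotv W (dentropy_vars U V).
Proof.
move=> GU; rewrite /hess -mulmxA (jac_mul _ C1v_grad_entropy GU).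
rewrite -[LHS]/(dotv V (dentropy_vars U W)); exact: dentropy_vars_sym.
Qed.

Lemma hess_entropy_sym U : G U -> (hess entropy U)^T = hess entropy U.
Proof.
move=> GU; apply/matrixP => i j; rewrite mxE.
have h k l : hess entropy U k l =
    ((delta_mx 0 k : 'rV_(dimU M)) *m hess entropy U *m (delta_mx 0 l : 'rV_(dimU M))^T) 0 0.
  by rewrite -rowE trmx_delta -colE !mxE.
rewrite (h j i) (h i j) (mul_hess_entropy _ _ GU) (mul_hess_entropy _ _ GU).
exact: dentropy_vars_sym.
Qed.

Lemma integ_segment f df a b x : C1 G f df -> G a -> G b -> 0 <= x <= 1 ->
  integ 0 x (fun t => df (a + t *: (b - a)) (b - a)) = f (a + x *: (b - a)) - f a.
Proof.
move=> hf Ga Gb /andP[x0 x1].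
have GU t : 0 <= t <= x -> G (a + t *: (b - a)).
  by move=> /andP[t0 tx]; apply: G_segment => //; rewrite t0 (le_trans tx).
have dF t : 0 <= t <= x -> is_derive t 1 (fun t => f (a + t *: (b - a)))
    (df (a + t *: (b - a)) (b - a)).
  by move=> /GU Gt; exact: (is_derive_segment hf Gt).
have cF : cont_on 0 x (fun t => df (a + t *: (b - a)) (b - a)).
  move=> t /GU Gt.
  apply: (for_continuous_segment (f := fun U => df U (b - a))).
  by have [_] := hf _ Gt; exact.
by have := integ_deriv x0 dF cF; rewrite scale0r addr0.
Qed.

Lemma C1_dotv_cst n (F : state R M -> 'rV[R]_n) dF v : C1v G F dF ->
  C1 G (fun U => dotv v (F U)) (fun U w => dotv v (dF U w)).
Proof.
move=> hF; apply: C1_eq (C1_dotv (C1v_cst (D := G) v) hF) _ _ => // U w.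
by rewrite dotv0l addr0.
Qed.

(** The right factor is arbitrary to serve both double integrals: it is d in the denominator and
    F'(a + xi d) d in the numerator, independent of zeta in either case. *)
Lemma hess_inner a b xi W : G a -> G b -> 0 <= xi <= 1 ->
  integ 0 xi (fun zeta =>
    ((b - a) *m hess entropy (a + zeta *: (b - a)) *m W^T) 0 0)
  = dotv W (entropy_vars (a + xi *: (b - a)) - entropy_vars a).
Proof.
move=> Ga Gb /andP[x0 x1].
rewrite (@eq_integ _ _ _ _ (fun t => dotv W (dentropy_vars (a + t *: (b - a)) (b - a)))).
  rewrite (integ_segment (C1_dotv_cst W C1v_entropy_vars))// ?x0//.
  by rewrite dotvDr dotvNr.
move=> t /andP[t0 tx]; rewrite mul_hess_entropy//.
by apply: G_segment => //; rewrite t0 (le_trans tx).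
Qed.

(** The inner integral leaves (V(U) - V(a)) . d, the derivative along the segment of entropy(U) -
    V(a) . U. *)
Lemma hess_integral1 a b : G a -> G b ->
  hess_integral a (b - a) (fun=> 1%:M) = relative_entropy a b.
Proof.
move=> Ga Gb.
have h := C1D C1_entropy (C1N (C1_dotv_cst (entropy_vars a)
  (C1_coord (D := G) : C1v G id (fun _ v => v)))).
have := integ_segment h Ga Gb (introT andP (conj ler01 (lexx 1))).
rewrite scale1r [a + _]addrC subrK => e.
rewrite /relative_entropy dotvDr dotvNr opprB.
have rearr (x y z t : R) : x - y + (z - t) = x - t - (y - z) by ring.
rewrite rearr -e; apply: eq_integ => t t01.
under eq_integ do rewrite mulmx1.
by rewrite hess_inner// dotvDr dotvNr !(dotvC (b - a)).
Qed.

Section System.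
Context (L : system R M) (hL : entropic L).

(** The inner integral leaves (V(U) - V(a)) . F'(U) d. Compatibility replaces V . F' d by the
    entropy flux differential minus (V . S) dB_x, and the source integral cancels the last term; the
    rest is an exact derivative. *)
Lemma es_numerator a b : G a -> G b ->
  hess_integral a (b - a) (fun xi => jac (flux L) (a + xi *: (b - a)))
  + source_integral L a (b - a)
  = eflux L b - eflux L a - dotv (entropy_vars a) (flux L b - flux L a).
Proof.
move=> Ga Gb; have [dF [dE [dS [hF hE hS hc]]]] := hL.
have h := C1D hE (C1N (C1_dotv_cst (entropy_vars a) hF)).
have hs := C1_dotv C1v_entropy_vars hS.
have Gt t : 0 <= t <= 1 -> G (a + t *: (b - a)) by exact: G_segment.
have := integ_segment h Ga Gb (introT andP (conj ler01 (lexx 1))).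
rewrite scale1r [a + _]addrC subrK => e.
rewrite dotvDr dotvNr opprB.
have rearr (x y z t : R) : x - y + (z - t) = x - t - (y - z) by ring.
rewrite rearr -e.
pose s t := dotv (entropy_vars (a + t *: (b - a))) (source L (a + t *: (b - a))) * dotv dmag_x (b - a).
pose g t := dE (a + t *: (b - a)) (b - a) - dotv (entropy_vars a) (dF (a + t *: (b - a)) (b - a)).
have cs : cont_on 0 1 s.
  move=> t /Gt Gt'; apply: continuousM; last exact: cst_continuous.
  apply: (for_continuous_segment (f := fun U => dotv (entropy_vars U) (source L U))).
  exact: C1_continuous hs Gt'.
have cg : cont_on 0 1 g.
  move=> t /Gt Gt'.
  apply: (for_continuous_segment
    (f := fun U => dE U (b - a) - dotv (entropy_vars a) (dF U (b - a)))).
  by have [_] := h _ Gt'; exact.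
have -> : source_integral L a (b - a) = integ 0 1 s.
  by apply: eq_integ => t /Gt Gt'; rewrite grad_entropy.
have -> : hess_integral a (b - a) (fun xi => jac (flux L) (a + xi *: (b - a)))
    = integ 0 1 (fun t => g t + - 1 * s t).
  apply: eq_integ => t t01; have Gt' := Gt _ t01.
  under eq_integ do rewrite -mulmxA (jac_mul _ hF Gt').
  rewrite hess_inner// dotvDr dotvNr /g /s hc// !(dotvC (dF _ _)); ring.
rewrite integD//; last by move=> t t01; apply: continuousM; [exact: cst_continuous|exact: cs].
by rewrite integ_scale// mulN1r subrK.
Qed.

Lemma SR_ESE a b Phi : G a -> G b -> SR_ES L a b Phi =
  (eflux L b - eflux L a - dotv (entropy_vars a) (flux L b - flux L a)
   - dotv (entropy_vars a) (pathJ L Phi)) / relative_entropy a b.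
Proof. by move=> Ga Gb; rewrite /SR_ES es_numerator// hess_integral1// grad_entropy. Qed.

Lemma SL_ESE a b Phi : G a -> G b -> SL_ES L a b Phi =
  (eflux L a - eflux L b - dotv (entropy_vars b) (flux L a - flux L b)
   + dotv (entropy_vars b) (pathJ L Phi)) / relative_entropy b a.
Proof. by move=> Ga Gb; rewrite /SL_ES es_numerator// hess_integral1// grad_entropy. Qed.

Lemma SR_ge0 a b Phi : 0 <= SR L a b Phi.
Proof. by rewrite /SR /SR_std; case: ifP; rewrite !le_max lexx ?orbT. Qed.

Lemma SL_le0 a b Phi : SL L a b Phi <= 0.
Proof. by rewrite /SL /SL_std; case: ifP; rewrite !ge_min lexx ?orbT. Qed.

Lemma T1_le0 b c Phi : G b -> G c -> SL L b c Phi < SR L b c Phi ->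
  b <> c \/ pathJ L Phi = 0 -> T1 L b c Phi <= 0.
Proof.
move=> Gb Gc hs hJ.
have sl0 := SL_le0 b c Phi; have sr0 := SR_ge0 b c Phi.
have key : eflux L c - eflux L b - dotv (entropy_vars b) (flux L c - flux L b)
    - dotv (entropy_vars b) (pathJ L Phi) <= SR L b c Phi * relative_entropy b c.
  (* For equal states [SR] is just the standard speed and gives no control of J; with J = 0 both
     sides are 0. *)
  have [bc|/eqP bc] := eqVneq b c.
    case: hJ => // ->; rewrite bc !subrr !dotv0r !subr0.
    by rewrite /relative_entropy !subrr dotv0r subr0 mulr0.
  have d0 : 0 < relative_entropy b c by apply: relative_entropy_gt0 => //; apply/eqP => /esym.
  rewrite -ler_pdivrMr// -SR_ESE// /SR; have /eqP/negPf -> := bc.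
  by rewrite le_max lexx orbT.
rewrite /T1 /num_flux /num_eflux /fluct_neg grad_entropy//.
move: key; rewrite /relative_entropy.
move: (SR L b c Phi) (SL L b c Phi) (entropy b) (entropy c) (entropy_vars b)
  (pathJ L Phi) (eflux L b) (eflux L c) (flux L b) (flux L c) hs sl0 sr0.
clear => sr sl Ub Uc v J Eb Ec Fb Fc hs sl0 sr0 key.
have dn0 : sr - sl != 0 by rewrite subr_eq0 gt_eqF.
(* [T1] is the nonnegative factor -S_L / (S_R - S_L) times the left side minus the right side of
   [key]. *)
have -> : (sr * Eb - sl * Ec + sr * sl * (Uc - Ub)) / (sr - sl) - Eb
   - dotv v ((sr - sl)^-1 *: (sr *: Fb - sl *: Fc + (sr * sl) *: (c - b)) - Fb
             + (- sl / (sr - sl)) *: J)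
  = (- sl) / (sr - sl) * ((Ec - Eb - dotv v (Fc - Fb) - dotv v J) - sr * (Uc - Ub - dotv v (c - b))).
  rewrite !dotvE_lin.
  move: (dotv v _) (dotv v _) (dotv v _) (dotv v _) (dotv v _) => *.
  by field.
apply: mulr_ge0_le0; last by rewrite subr_le0.
by rewrite divr_ge0 ?oppr_ge0// subr_ge0 ltW.
Qed.

Lemma T2_ge0 a b Phi : G a -> G b -> SL L a b Phi < SR L a b Phi ->
  a <> b \/ pathJ L Phi = 0 -> 0 <= T2 L a b Phi.
Proof.
move=> Ga Gb hs hJ.
have sl0 := SL_le0 a b Phi; have sr0 := SR_ge0 a b Phi.
have key : SL L a b Phi * relative_entropy b a
    <= eflux L a - eflux L b - dotv (entropy_vars b) (flux L a - flux L b)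
       + dotv (entropy_vars b) (pathJ L Phi).
  have [ab|/eqP ab] := eqVneq a b.
    case: hJ => // ->; rewrite ab !subrr !dotv0r subr0 addr0.
    by rewrite /relative_entropy !subrr dotv0r subr0 mulr0.
  have d0 : 0 < relative_entropy b a by apply: relative_entropy_gt0 => //; exact/eqP.
  rewrite -ler_pdivlMr// -SL_ESE// /SL; have /eqP/negPf -> := ab.
  by rewrite ge_min lexx orbT.
rewrite /T2 /num_flux /num_eflux /fluct_pos grad_entropy//.
move: key; rewrite /relative_entropy.
move: (SR L a b Phi) (SL L a b Phi) (entropy a) (entropy b) (entropy_vars b)
  (pathJ L Phi) (eflux L a) (eflux L b) (flux L a) (flux L b) hs sl0 sr0.
clear => sr sl Ua Ub v J Ea Eb Fa Fb hs sl0 sr0 key.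
have dn0 : sr - sl != 0 by rewrite subr_eq0 gt_eqF.
have -> : (sr * Ea - sl * Eb + sr * sl * (Ub - Ua)) / (sr - sl) - Eb
   - dotv v ((sr - sl)^-1 *: (sr *: Fa - sl *: Fb + (sr * sl) *: (b - a)) - Fb
             - (sr / (sr - sl)) *: J)
  = sr / (sr - sl) * ((Ea - Eb - dotv v (Fa - Fb) + dotv v J) - sl * (Ua - Ub - dotv v (a - b))).
  rewrite !dotvE_lin.
  move: (dotv v _) (dotv v _) (dotv v _) (dotv v _) (dotv v _) => *.
  by field.
apply: mulr_ge0; last by rewrite subr_ge0.
by rewrite divr_ge0// subr_ge0 ltW.
Qed.

End System.
End EntropyStableSpeeds.

(** * Three-point schemes *)

Section ThreePoint.
Context {R : realType} {M : nat}.
Implicit Types (U V a b c : state R M).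
Local Notation G := (@G R M).

Lemma mvt_at0 (f df : R -> R) (x : R) : 0 <= x ->
  (forall t : R, 0 <= t <= x -> is_derive t 1 f (df t)) ->
  exists2 c, 0 <= c <= x & f x - f 0 = df c * x.
Proof.
move=> x0 hf; have [||c] := @MVT_segment _ f df 0 x x0.
- by move=> t; rewrite in_itv/= => /andP[/ltW ? /ltW ?]; apply: hf; apply/andP.
- apply: cont_on_within => t /hf[/derivable1_diffP/differentiable_continuous ct _].
  exact: ct.
by rewrite in_itv/= subr0 => c0x e; exists c.
Qed.

(** The mean value theorem is applied twice: to the entropy along the segment minus the quadratic
    [p] with the same slope at 0 and second derivative [K], and then to [g], to see that the
    derivative g s - g 0 - K s of that difference is nonpositive. *)
Lemma entropy_taylor b b' K : G b -> G b' ->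
  (forall t, 0 <= t <= 1 ->
     dotv (b' - b) (dentropy_vars (b + t *: (b' - b)) (b' - b)) <= K) ->
  entropy b' <= entropy b + dotv (entropy_vars b) (b' - b) + K / 2%:R.
Proof.
move=> Gb Gb' hK; set d := b' - b.
have Gt (t : R) : 0 <= t <= 1 -> G (b + t *: d) by exact: G_segment.
pose g t := dotv d (entropy_vars (b + t *: d)).
have dg (t : R) : 0 <= t <= 1 -> is_derive t 1 g (dotv d (dentropy_vars (b + t *: d) d)).
  by move=> /Gt Gt'; exact: (is_derive_segment (C1_dotv_cst d C1v_entropy_vars) Gt').
pose p : {poly R} := g 0 *: 'X + (K / 2%:R) *: 'X^2.
have dp t : p^`().[t] = g 0 + K * t.
  by rewrite /p !poly.derivE !hornerE; field.
pose f t := entropy (b + t *: d) - p.[t].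
have df (t : R) : 0 <= t <= 1 -> is_derive t 1 f (g t - (g 0 + K * t)).
  move=> /Gt Gt'; rewrite -dp /g dotvC.
  exact: is_deriveB (is_derive_segment C1_entropy Gt') (is_derive_poly p t).
have [s /andP[s0 s1]] := mvt_at0 ler01 df.
have gs : g s - g 0 <= K * s.
  have [|r /andP[r0 rs] ->] := mvt_at0 s0 (df := fun t => dotv d (dentropy_vars (b + t *: d) d)) (f := g).
    by move=> t /andP[t0 ts]; apply: dg; rewrite t0 (le_trans ts).
  by apply: ler_wpM2r => //; apply: hK; rewrite r0 (le_trans rs).
have p1 : p.[1] = g 0 + K / 2%:R by rewrite /p !hornerE /=; ring.
have p0 : p.[0] = 0 by rewrite /p !hornerE /=; ring.
rewrite /f p1 p0 scale0r scale1r addr0 [b + _]addrC subrK.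
have -> : dotv (entropy_vars b) d = g 0 by rewrite /g scale0r addr0 dotvC.
move: gs; move: (g s) (g 0) (entropy b) (entropy b') => x y z t.
by rewrite mulr1 subr0; lra.
Qed.

Section System.
Context (L : system R M).

(** [T1] and [T2] are both taken relative to the middle state: the exact fluxes at [b] cancel, and
    the two fluctuations add up because they enter with opposite signs. *)
Lemma num_eflux_diff a b c Phi1 Phi2 :
  num_eflux L b c Phi2 - num_eflux L a b Phi1 =
  T1 L b c Phi2 - T2 L a b Phi1 + dotv (grad entropy b) (T3 L a b c Phi1 Phi2).
Proof.
rewrite /T1 /T2 /T3.
move: (num_eflux L b c Phi2) (num_eflux L a b Phi1) (num_flux L b c Phi2) (num_flux L a b Phi1).
move: (fluct_neg L b c Phi2) (fluct_pos L a b Phi1) (grad entropy b) (flux L b) (eflux L b).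
move=> n p v F E e1 e2 f1 f2; rewrite !dotvE_lin; ring.
Qed.

Lemma three_point mu a b c Phi1 Phi2 : G b -> 0 <= mu ->
  T1 L b c Phi2 <= 0 -> 0 <= T2 L a b Phi1 -> cfl3 L mu a b c Phi1 Phi2 ->
  entropy (b - mu *: T3 L a b c Phi1 Phi2)
  <= entropy b - mu * (num_eflux L b c Phi2 - num_eflux L a b Phi1).
Proof.
move=> Gb mu0 t1 t2 [Gn]; rewrite num_eflux_diff.
move: (T1 L b c Phi2) (T2 L a b Phi1) t1 t2 => t1 t2 t1_le0 t2_ge0.
move: (T3 L a b c Phi1 Phi2) Gn => v Gn.
have [->|v0] := eqVneq v 0.
  rewrite scaler0 subr0 (dotv0r (grad entropy b)) addr0 => _.
  by rewrite lerBrDr gerDl mulr_ge0_le0// subr_le0 (le_trans t1_le0).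
case=> [/eqP|]; first by rewrite (negPf v0).
have vp : 0 < dotv v v by rewrite lt0r dotv_eq0 v0 dotv_ge0.
have [->|mup] := eqVneq mu 0; first by rewrite scale0r mul0r !subr0.
have {}mup : 0 < mu by rewrite lt0r mup.
set S := max_hess_eig _ _ => hmu.
(* With S <= 0 the CFL bound would be nonpositive, against 0 < mu. *)
have S0 : 0 < S.
  rewrite -invr_gt0 ltNge; apply/negP => Sn; move: mup; apply/negP; rewrite -leNgt.
  apply: (le_trans hmu); apply: mulr_ge0_le0 => //.
  by rewrite divr_ge0 ?(ltW vp)// mulr_ge0// subr_ge0 (le_trans t1_le0).
(* A set without a supremum has [sup] equal to 0, so S > 0 already shows that the maximal
   eigenvalues along the segment are bounded. *)
have hS : has_sup [set sigma_max (hess entropy (b + t *: (b - mu *: v - b))) | t in `[0%R, 1%R]].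
  by apply/not_notP => /sup_out e; move: S0; rewrite /S /max_hess_eig e ltxx.
pose d := b - mu *: v - b; have dE : d = - mu *: v.
  by rewrite /d addrAC subrr sub0r scaleNr.
have hK (t : R) : 0 <= t <= 1 -> dotv d (dentropy_vars (b + t *: d) d) <= S * dotv d d.
  move=> t01; have Gt : G (b + t *: d) by exact: G_segment.
  rewrite -mul_hess_entropy// -[leLHS]/(dotv (d *m _) d) dotvC.
  have := @quad_le_sigma_max R _ (hess entropy (b + t *: d)) (hess_entropy_sym Gt) d.
  move=> /le_trans -> //; apply: ler_wpM2r; first exact: dotv_ge0.
  apply: ub_le_sup; first by case: hS.
  by exists t => //=; rewrite in_itv.
apply: (le_trans (entropy_taylor Gb Gn hK)).
rewrite -/d dE !dotvE_lin grad_entropy//.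
(* The CFL bound in product form. Multiplied by mu / 2, it says that the Taylor remainder is
   absorbed by the dissipation mu (T2 - T1). *)
have : mu * (dotv v v * S) <= 2%:R * (t2 - t1).
  by rewrite -ler_pdivlMr ?mulr_gt0// invfM mulrA.
move=> /(ler_wpM2l mu0) h.
move: (entropy b) (dotv (entropy_vars b) v) => x y.
have -> : S * (- mu * (- mu * dotv v v)) / 2%:R = mu * (mu * (dotv v v * S)) / 2%:R by ring.
have : mu * (mu * (dotv v v * S)) / 2%:R <= mu * (t2 - t1).
  by rewrite ler_pdivrMr// (le_trans h)// le_eqVlt; apply/orP; left; apply/eqP; ring.
have -> : mu * (t1 - t2 + y) = mu * y - mu * (t2 - t1) by ring.
lra.
Qed.

End System.
End ThreePoint.

(** * Gauss--Lobatto quadrature *)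

Section IntegTransport.
Context {R : realType}.
Implicit Types (x y z t : R) (f : R -> R).

Lemma integ_subst y z f : y < z -> cont_on y z f ->
  integ y z f = integ 0 1 (fun t => (z - y) * f (y + t * (z - y))).
Proof.
move=> yz cf; pose q : {poly R} := y%:P + (z - y) *: 'X; pose F := horner q.
have zy : 0 < z - y by rewrite subr_gt0.
have FE t : F t = y + t * (z - y) by rewrite /F /q !hornerE /= mulrC.
have dF (t : R) : is_derive t 1 F (z - y).
  have <- : q^`()%R.[t] = z - y by rewrite /q !poly.derivE !hornerE.
  exact: is_derive_poly.
have F' : F^`()%classic = cst (z - y) by apply/funext => t; rewrite derive1E derive_val.
have F0 : F 0 = y by rewrite FE mul0r addr0.
have F1 : F 1 = z by rewrite FE mul1r addrC subrK.
have cF (t : R) : F @ t --> F t.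
  by have [/derivable1_diffP/differentiable_continuous] := dF t.
rewrite /integ /Rintegral -{1}F0 -{1}F1.
rewrite (@integration_by_substitution_increasing _ F f 0 1)//.
- by congr fine; apply: eq_integral => t _ /=; rewrite -FE mulrC /= F'.
- by move=> s t _ _ st; rewrite !FE ltrD2l ltr_pM2r.
- by rewrite F' => t _; exact: cst_continuous.
- by rewrite F'; exact: is_cvg_cst.
- by rewrite F'; exact: is_cvg_cst.
- split; first by move=> t _; case: (dF t).
    by apply: cvg_at_right_filter; exact: cF.
  by apply: cvg_at_left_filter; exact: cF.
- by rewrite F0 F1; exact: cont_on_within.
Qed.

Lemma integ_split x y z f : x <= y -> y <= z -> cont_on x z f ->
  integ x z f = integ x y f + integ y z f.
Proof.
move=> xy yz cf; have i := cont_on_integrable cf.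
apply/eqP; rewrite addrC -subr_eq; apply/eqP; rewrite /integ.
rewrite Rintegral_itvB ?bnd_simp//; apply: Rintegral_itv_obnd_cbnd.
apply: (integrableS _ _ _ i) => //; apply: subset_itvr; rewrite bnd_simp.
exact: xy.
Qed.

End IntegTransport.

Section PolynomialIntegrals.
Context {R : realType}.
Implicit Types (p F : {poly R}).

Lemma poly_primitive p : exists F, F^`()%R = p.
Proof.
exists (\poly_(i < (size p).+1) (p`_i.-1 / i%:R)); apply/polyP => i.
rewrite coef_deriv coef_poly ltnS; case: ltnP => [_|h].
  by rewrite /= -[LHS]mulr_natr divfK// pnatr_eq0.
by rewrite mul0rn nth_default.
Qed.

Lemma cont_on_poly p (x y : R) : cont_on x y (horner p).
Proof. by move=> t _; exact: continuous_horner. Qed.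

(** A primitive is nondecreasing on [0, 1]. If the integral vanished it would be constant there,
    hence a constant polynomial, and [p] would be 0. *)
Lemma integ_poly_gt0 p : p != 0 -> (forall t, 0 <= t <= 1 -> 0 <= p.[t]) ->
  0 < integ 0 1 (fun t => p.[t]).
Proof.
move=> pn0 p0; have [F Fp] := poly_primitive p.
have FTC (x y : R) : x <= y -> integ x y (fun t => p.[t]) = F.[y] - F.[x].
  move=> xy; apply: (integ_deriv (F := horner F)) => //; last exact: cont_on_poly.
  by move=> t _; rewrite -Fp; exact: is_derive_poly.
have Fle (x y : R) : 0 <= x -> x <= y -> y <= 1 -> F.[x] <= F.[y].
  move=> x0 xy y1; rewrite -subr_ge0 -FTC//; apply: Rintegral_ge0 => t /=.
  rewrite in_itv/= => /andP[xt ty]; apply: p0.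
  by rewrite (le_trans x0 xt) (le_trans ty y1).
rewrite lt0r; apply/andP; split; last first.
  by apply: Rintegral_ge0 => t /=; rewrite in_itv/= => /p0.
apply: contra pn0; rewrite FTC// subr_eq0 => /eqP F10.
pose Q := F - (F.[0])%:P.
have Q0 : Q = 0.
  (* As many distinct points of [0, 1] as [Q] has coefficients, all of them roots. *)
  pose s := [seq (j.+1%:R)^-1 : R | j <- iota 0 (size Q)].
  apply: (roots_geq_poly_eq0 (rs := s)); last by rewrite size_map size_iota.
    apply/allP => _ /mapP[j _ ->]; rewrite rootE /Q !hornerE subr_eq0.
    have j0 : 0 <= (j.+1%:R : R)^-1 by rewrite invr_ge0.
    have j1 : (j.+1%:R : R)^-1 <= 1 by rewrite invf_le1// ler1n.
    by rewrite eq_le [X in _ && X]Fle// andbT -F10 Fle.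
  rewrite map_inj_uniq ?iota_uniq// => i j /invr_inj/eqP.
  by rewrite eqr_nat => /eqP[].
by rewrite -Fp -(subrK (F.[0])%:P F) -/Q Q0 add0r derivC.
Qed.

End PolynomialIntegrals.

Section GaussLobatto.
Context {R : realType} (N : nat) (xhat w : 'I_N.+2 -> R).
Hypothesis hGL : gauss_lobatto xhat w.
Implicit Type q : 'I_N.+2.

Lemma gl_node_inj : injective xhat.
Proof.
have [mono _ _ _] := hGL => q r e; apply/val_inj/eqP; rewrite eqn_leq.
apply/andP; split; rewrite leqNgt; apply/negP => /mono; rewrite e ltxx//.
Qed.

Lemma gl_node_itv q : 0 <= xhat q <= 1.
Proof.
have [mono x0 x1 _] := hGL; apply/andP; split.
  have [->|q0] := eqVneq q ord0; first by rewrite x0.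
  by rewrite -x0 ltW// mono//= lt0n.
have [->|q1] := eqVneq q ord_max; first by rewrite x1.
rewrite -x1 ltW// mono//= ltn_neqAle -ltnS ltn_ord andbT.
by apply: contra q1 => /eqP e; apply/eqP/val_inj.
Qed.

Lemma gl_node_int q : (0 < q < N.+1)%N -> 0 < xhat q < 1.
Proof.
have [mono x0 x1 _] := hGL => /andP[q0 q1].
by rewrite -{1}x0 -{1}x1 !mono.
Qed.

Lemma gl_sum1 : \sum_q w q = 1.
Proof.
have [_ _ _ ex] := hGL; have := ex 1; rewrite size_poly1 => /(_ isT).
under eq_bigr do rewrite hornerC mulr1.
move=> ->; rewrite (@eq_integ _ _ _ _ (cst 1)); last by move=> t _; rewrite hornerC.
by rewrite /integ Rintegral_cst//= lebesgue_measure_itv/= lte_fin ltr01 /= subr0 mul1r.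
Qed.

(* Exactness on X (1 - X) prod_(r <> q) (X - x_r)^2, over interior r and with the
   factor of an end point dropped when q is that end point. *)
Lemma gl_weight_gt0 q : 0 < w q.
Proof.
have [mono x0 x1 ex] := hGL.
pose A : {poly R} := if q == ord0 then 1 else 'X.
pose B : {poly R} := if q == ord_max then 1 else 1 - 'X.
pose int r := (r != q) && (0 < r < N.+1)%N.
pose C : {poly R} := \prod_(r | int r) ('X - (xhat r)%:P).
pose p := A * B * C ^+ 2.
have Ct t : C.[t] = \prod_(r | int r) (t - xhat r).
  by rewrite /C horner_prod; apply: eq_bigr => r _; rewrite !hornerE.
have At t : A.[t] = if q == ord0 then 1 else t by rewrite /A; case: eqP; rewrite !hornerE.
have Bt t : B.[t] = if q == ord_max then 1 else 1 - t by rewrite /B; case: eqP; rewrite !hornerE.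
have pt t : p.[t] = A.[t] * B.[t] * C.[t] ^+ 2 by rewrite /p !hornerE.
have p0 t : 0 <= t <= 1 -> 0 <= p.[t].
  move=> /andP[t0 t1]; rewrite pt mulr_ge0 ?sqr_ge0// At Bt.
  by rewrite mulr_ge0//; case: ifP; rewrite ?subr_ge0.
have pq : 0 < p.[xhat q].
  rewrite pt mulr_gt0//; last first.
    rewrite exprn_even_gt0//= Ct; apply/prodf_neq0 => r /andP[rq _].
    by rewrite subr_eq0; apply: contra rq => /eqP/gl_node_inj ->.
  rewrite At Bt mulr_gt0//.
    case: eqVneq => // q0; rewrite -x0 mono//= lt0n.
    by apply: contra q0 => /eqP e; apply/eqP/val_inj.
  case: eqVneq => // q1; rewrite subr_gt0 -x1 mono//= ltn_neqAle -ltnS ltn_ord andbT.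
  by apply: contra q1 => /eqP e; apply/eqP/val_inj.
have pr r : r != q -> p.[xhat r] = 0.
  move=> rq; have [r0|r0] := eqVneq r ord0.
    by rewrite pt At ifF ?r0 ?x0 ?mul0r//; apply/negP => /eqP q0; rewrite r0 q0 eqxx in rq.
  have [r1|r1] := eqVneq r ord_max.
    by rewrite pt Bt ifF ?r1 ?x1 ?subrr ?mulr0 ?mul0r//; apply/negP => /eqP q0; rewrite r1 q0 eqxx in rq.
  rewrite pt Ct (bigD1 r)/=; first by rewrite subrr mul0r expr0n/= mulr0.
  rewrite /int rq lt0n /=; apply/andP; split.
    by apply: contra r0 => /eqP e; apply/eqP/val_inj.
  rewrite ltn_neqAle -ltnS ltn_ord andbT.
  by apply: contra r1 => /eqP e; apply/eqP/val_inj.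
have sC : size C = #|int|.+1
  by rewrite /C -big_enum size_prod_XsubC cardE.
have pn0 : p != 0 by apply/eqP => e; move: pq; rewrite e horner0 ltxx.
have sp : (size p <= (N.+2).*2 - 2)%N.
  have sA : (size A = (q != ord0).+1)%N by rewrite /A; case: eqP; rewrite ?size_poly1 ?size_polyX.
  have sB : (size B = (q != ord_max).+1)%N.
    rewrite /B; case: eqP; rewrite ?size_poly1// => _.
    by rewrite -opprB size_polyN -[1]/(1%:P) size_XsubC.
  have q01 : (0 < (q != ord0) + (q != ord_max))%N.
    by case: (eqVneq q ord0) => [->|].
  (* For an interior [q] there are N - 1 squared factors and two linear ones, degree 2 N; for an end
     point there are N and one, degree 2 N + 1, the full exactness of the rule. *)
  have cI : (#|int| + (q != ord0) + (q != ord_max) <= N.+1)%N.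
    have := cardC int; rewrite card_ord.
    have : (#|q |: [set ord0; ord_max]| <= #|[predC int]|)%N.
      apply: subset_leq_card; apply/fintype.subsetP => r hr; rewrite inE; apply/negP => ir.
      have /and3P[rq r0 r1] : int r := ir.
      move: hr; rewrite !inE (negPf rq) /= => /orP[]/eqP e.
        by move: r0; rewrite e.
      by move: r1; rewrite e ltnn.
    have n01 : (ord0 : 'I_N.+2) != ord_max by [].
    rewrite cardsU1 cards2 !inE negb_or n01 /= => h1 h2.
    move: h1 h2 q01; move: #|int| #|[predC int]| (q != ord0) (q != ord_max) => u v.
    by case=> -[] /=; lia.
  apply: (leq_trans (size_polyMleq _ _)).
  have := size_polyMleq A B; have := size_polyMleq C C.
  rewrite -expr2 sA sB sC; move: q01 cI; rewrite -/p.
  move: #|int| (q != ord0) (q != ord_max) (size (A * B)) (size (C ^+ 2)) => u.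
  by case=> -[] s t /=; lia.
have := ex p sp; rewrite (bigD1 q)//= big1 ?addr0 => [e|r rq]; last by rewrite pr ?mulr0.
by have := integ_poly_gt0 pn0 p0; rewrite -e pmulr_lgt0.
Qed.

End GaussLobatto.

(** * Forward Euler steps *)

Section PolynomialPaths.
Context {R : realType} {M : nat}.
Implicit Types (f : 'rV[{poly R}]_(dimU M)) (x y z t : R) (U : dgfun R M).
Local Notation G := (@G R M).

Lemma peval_coord f x j : peval f x 0 j = (f 0 j).[x].
Proof. by rewrite mxE. Qed.

Lemma continuous_peval f : continuous (peval f).
Proof.
move=> x; apply/differentiable_continuous/derivable1_diffP/derivable_mxP => i j.
have -> : (fun t => peval f t i j) = horner (f i j) by apply/funext => t; rewrite mxE.
exact: derivable_horner.
Qed.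

Lemma mag_x_peval f x : mag_x (peval f x) =
  (f 0 (rshift _ (rshift _ (rshift _ 0)))).[x].
Proof. by rewrite /mag_x /magnetic !mxE. Qed.

(** Values and increments are bounded together because, in the induction on p X + c, the increment
    involves the values of p. *)
Lemma poly_lipschitz01 (p : {poly R}) : exists2 C : R, 0 <= C &
  forall t, 0 <= t <= 1 -> `|p.[t]| <= C /\
  forall s, 0 <= s <= 1 -> `|p.[t] - p.[s]| <= C * `|t - s|.
Proof.
elim/poly_ind: p => [|p c [C C0 IH]].
  by exists 0 => // t _; rewrite horner0 normr0; split=> // s _; rewrite horner0 subrr normr0 mul0r.
exists (C + C + `|c|) => [|t /[dup] t01 /andP[t0 t1]]; first by rewrite !addr_ge0.
have [bt lt] := IH _ t01; have nt : `|t| <= 1 by rewrite ger0_norm.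
split=> [|s s01]; rewrite !hornerE.
  rewrite (le_trans (ler_normD _ _))// lerD2r normrM ler_wpDr//.
  by rewrite (le_trans (ler_wpM2l (normr_ge0 _) nt))// mulr1.
have [bs _] := IH _ s01.
have -> : p.[t] * t + c - (p.[s] * s + c) = (p.[t] - p.[s]) * t + p.[s] * (t - s) by ring.
rewrite (le_trans (ler_normD _ _))// !normrM -addrA mulrDl lerD//.
  by rewrite (le_trans (ler_wpM2l (normr_ge0 _) nt))// mulr1 lt.
by rewrite ler_wpM2r// ler_wpDr.
Qed.

Lemma horner_affine y z t : (y%:P + (z - y) *: 'X).[t] = y + t * (z - y).
Proof. by rewrite !hornerE mulrC. Qed.

Definition cell_poly U i y z : 'rV[{poly R}]_(dimU M) :=
  map_mx (fun p : {poly R} => p \Po (y%:P + (z - y) *: 'X)) (U i).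

Lemma cell_pathE U i y z t : cell_path U i y z t = peval (cell_poly U i y z) t.
Proof.
apply/rowP => j; rewrite /cell_path !peval_coord mxE horner_comp.
by rewrite horner_affine.
Qed.

Lemma derive1_peval f x : derive1 (peval f) x = peval (pderiv f) x.
Proof.
rewrite derive1E derive_mx; last first.
  apply/derivable_mxP => i j.
  have -> : (fun t => peval f t i j) = horner (f i j) by apply/funext => t; rewrite mxE.
  exact: derivable_horner.
apply/rowP => j; rewrite !mxE horner_evalE.
have -> : (fun t => peval f t 0 j) = horner (f 0 j) by apply/funext => t; rewrite mxE.
by rewrite derive_val.
Qed.

Lemma derive1_cell_path U i y z t : derive1 (cell_path U i y z) t =
  (z - y) *: peval (pderiv (U i)) (y + t * (z - y)).
Proof.
have -> : cell_path U i y z = peval (cell_poly U i y z).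
  by apply/funext => s; rewrite cell_pathE.
rewrite derive1_peval; apply/rowP => j; rewrite !mxE !horner_evalE deriv_comp.
rewrite hornerM horner_comp horner_affine.
have -> : (y%:P + (z - y) *: 'X)^`()%R = (z - y)%:P.
  by rewrite !poly.derivE add0r alg_polyC.
by rewrite hornerC mulrC.
Qed.

(** Needed because S_L < S_R is granted along generalized paths; the Lipschitz constant is the sum
    of those of the coordinates. *)
Lemma cell_path_generalized U i y z : y < z ->
  (forall x, y <= x <= z -> G (peval (U i) x)) ->
  generalized_path (peval (U i) y) (peval (U i) z) (cell_path U i y z).
Proof.
move=> yz hG; split.
- have hC j : exists C : R, 0 <= C /\ forall t s, 0 <= t <= 1 -> 0 <= s <= 1 ->
      `|cell_path U i y z t 0 j - cell_path U i y z s 0 j| <= C * `|t - s|.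
    have [C C0 hC] := poly_lipschitz01 (cell_poly U i y z 0 j).
    exists C; split=> // t s t01 s01; rewrite !cell_pathE !peval_coord.
    by have [_] := hC _ t01; exact.
  have {hC} [C hC] := choice hC.
  have PF : ProperFilter (globally (`[0, 1]%classic `*` `[0, 1]%classic : set (R * R))).
    by apply: (globally_properfilter (a := (0, 0))); split; rewrite /= in_itv/= lexx ler01.
  apply: (@klipschitzW _ _ _ (\sum_j C j)).
  move=> [t s] [/=]; rewrite !in_itv/= => t01 s01.
  rewrite [leLHS]/Num.Def.normr/= mx_normrE; apply: bigmax_le => [|[k j] _].
    by rewrite mulr_ge0// sumr_ge0// => j _; case: (hC j).
  rewrite !mxE ord1 /=; have [C0 /(_ t s t01 s01)] := hC j; rewrite !mxE => h.
  apply: (le_trans h).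
  rewrite ler_wpM2r// (bigD1 j)//= lerDl sumr_ge0// => l _; by case: (hC l).
- move=> t /andP[t0 t1]; apply: hG; rewrite lerDl mulr_ge0 ?subr_ge0 ?(ltW yz)//=.
  by rewrite -lerBrDl ler_piMl// subr_ge0 ltW.
- by rewrite /cell_path mul0r addr0.
- by rewrite /cell_path mul1r addrC subrK.
Qed.

Lemma pathJ_const (L : system R M) a Phi :
  (forall t : R, 0 <= t <= 1 -> Phi t = a) -> pathJ L Phi = 0.
Proof.
move=> hP; apply/rowP => j; rewrite mxE [RHS]mxE.
rewrite (@eq_integ_oo _ 0 1 _ (cst 0)).
- by rewrite /integ Rintegral_cst//= mul0r.
- by move=> t _; exact: cst_continuous.
move=> t /andP[t0 t1]; rewrite derive1E.
have n : \near t, Phi t = cst a t.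
  have : t \in `]0, 1[%R by rewrite in_itv/= t0.
  move=> /near_in_itvoo; apply: filterS => s; rewrite in_itv/=.
    by move=> /andP[/ltW ? /ltW ?]; apply: hP; apply/andP.
by rewrite (near_eq_derive _ n) derive_cst dotv0r scale0r mxE.
Qed.

Section CellSource.
Context (L : system R M) (hL : entropic L) (U : dgfun R M) (i : int).

Definition cell_source x : state R M :=
  mag_x (peval (pderiv (U i)) x) *: source L (peval (U i) x).

Lemma cont_cell_source y z j : (forall x, y <= x <= z -> G (peval (U i) x)) ->
  cont_on y z (fun x => cell_source x 0 j).
Proof.
move=> hG x /hG Gx; have [dF [dE [dS [_ _ hS _]]]] := hL.
have -> : (fun x => cell_source x 0 j) =
    (fun x => (pderiv (U i) 0 (rshift _ (rshift _ (rshift _ 0)))).[x] * source L (peval (U i) x) 0 j).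
  by apply/funext => t; rewrite /cell_source mxE mag_x_peval.
apply: continuousM; first exact: continuous_horner.
apply: (@continuous_comp _ _ _ (peval (U i)) (fun V => source L V 0 j)).
  exact: continuous_peval.
exact: (C1_continuous (hS j) Gx).
Qed.

(** J does not see the parametrization: the factor z - y from the chain rule is that of the change
    of variable. This turns the volume source term of the DG operator into path integrals. *)
Lemma pathJ_cell_path y z : y < z ->
  (forall x, y <= x <= z -> G (peval (U i) x)) ->
  pathJ L (cell_path U i y z) = vinteg y z cell_source.
Proof.
move=> yz hG; apply/rowP => j; rewrite [LHS]mxE [RHS]mxE.
rewrite (integ_subst yz (cont_cell_source (j := j) hG)).
apply: eq_integ => t _; rewrite derive1_cell_path dmag_xE /cell_source !mxE.
by rewrite /mag_x magneticZ mxE -mulrA.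
Qed.

Lemma pathJ_cell_path_split x y z : x < y -> y < z ->
  (forall t, x <= t <= z -> G (peval (U i) t)) ->
  pathJ L (cell_path U i x y) + pathJ L (cell_path U i y z) = pathJ L (cell_path U i x z).
Proof.
move=> xy yz hG; rewrite !pathJ_cell_path//.
- apply/rowP => j; rewrite !mxE (integ_split (ltW xy) (ltW yz))//.
  exact: cont_cell_source.
- exact: lt_trans yz.
- by move=> t /andP[yt tz]; apply: hG; rewrite tz (le_trans (ltW xy)).
- by move=> t /andP[xt ty]; apply: hG; rewrite xt (le_trans ty (ltW yz)).
Qed.

End CellSource.
End PolynomialPaths.

Lemma sum_if2 (I : finType) (V : nmodType) (a b : I) (x y : V) : a != b ->
  \sum_q (if q == a then x else if q == b then y else 0) = x + y.
Proof.
move=> ab; have ba : b != a by rewrite eq_sym.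
rewrite (bigD1 a)//= eqxx (bigD1 b)//= (negPf ba) eqxx.
by rewrite big1 ?addr0// => q /andP[/negPf -> /negPf ->].
Qed.

Lemma sum_if3 (I : finType) (V : nmodType) (a b c : I) (x y z : V) :
  a != b -> c != a -> c != b ->
  \sum_q (if q == a then x else if q == b then y else if q == c then z else 0)
  = x + y + z.
Proof.
move=> ab ca cb; have ba : b != a by rewrite eq_sym.
rewrite (bigD1 a)//= eqxx (bigD1 b)//= (negPf ba) eqxx.
rewrite (bigD1 c) ?ca ?cb//= (negPf ca) (negPf cb) eqxx addrA.
by rewrite big1 ?addr0// => q /andP[/andP[/negPf -> /negPf ->] /negPf ->].
Qed.

(** The sum of two [T3]. The flux [f] between the two end states of the cell drops out, and its
    fluctuations [q], [p] remain to form J. *)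
Lemma telescope2 (R : realType) n (f fl fr p pl q qr : 'rV[R]_n) :
  (f - fl + q + pl) + (fr - f + qr + p) = fr - fl + qr + pl + (q + p).
Proof. by apply/rowP => j; rewrite !mxE; ring. Qed.

(** The same with the cell cut in two, with fluxes [f], [g] and fluctuations [q], [p] and [t], [r].
    The summands belong to the first, last and interior nodes, the order of [sum_if3]. *)
Lemma telescope3 (R : realType) n (f g fl fr p pl q qr r t : 'rV[R]_n) :
  (f - fl + q + pl) + (fr - g + qr + r) + (g - f + t + p)
  = fr - fl + qr + pl + ((q + p) + (t + r)).
Proof. by apply/rowP => j; rewrite !mxE; ring. Qed.

Section ForwardEuler.
Context {R : realType} {M : nat}.
Local Notation G := (@G R M).
Context (x0 h : R) (hh : 0 < h) (Psi : R -> state R M -> state R M -> state R M).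
Implicit Types (i : int) (a b c : state R M) (Phi : R -> state R M) (mu : R).

Lemma xfaceS i : xface x0 h (i + 1) = xface x0 h i + h.
Proof. by rewrite /xface intrD mulrDl mul1r addrA. Qed.

Lemma xface_lt i : xface x0 h i < xface x0 h (i + 1).
Proof. by rewrite xfaceS ltrDl. Qed.

Section Quadrature.
Context (k N : nat) (hkN : (k.+1 <= N.+2)%N) (xhat w : 'I_N.+2 -> R).
Hypothesis hGL : gauss_lobatto xhat w.
Context (U : dgfun R M).
Local Notation node := (node x0 h xhat).

Lemma node0 i : node i ord0 = xface x0 h i.
Proof. by have [_ e _ _] := hGL; rewrite /node e mul0r addr0. Qed.

Lemma node_max i : node i ord_max = xface x0 h (i + 1).
Proof. by have [_ _ e _] := hGL; rewrite /node e mul1r xfaceS. Qed.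

Lemma node_itv i q : xface x0 h i <= node i q <= xface x0 h (i + 1).
Proof.
have /andP[q0 q1] := gl_node_itv hGL q.
by rewrite xfaceS lerDl lerD2l mulr_ge0 ?(ltW hh)//= ler_piMl ?(ltW hh).
Qed.

Lemma node_int i (q : 'I_N.+2) : (0 < q < N.+1)%N -> xface x0 h i < node i q < xface x0 h (i + 1).
Proof.
move=> /(gl_node_int hGL)/andP[q0 q1].
by rewrite xfaceS ltrDl ltrD2l mulr_gt0//= gtr_pMl.
Qed.

(** The degree is at most k <= N + 1 <= 2 N + 1, within the exactness of the rule, and the affine
    change of variable does not raise it. *)
Lemma cell_average_node i : in_Vh k U ->
  cell_average x0 h U i = \sum_q w q *: peval (U i) (node i q).
Proof.
move=> hU; have [_ _ _ ex] := hGL; apply/rowP => j.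
rewrite mxE [vinteg _ _ _ 0 j]mxE summxE.
set p := U i 0 j; set y := xface x0 h i; set z := xface x0 h (i + 1).
have zy : z - y = h by rewrite /z xfaceS addrC addKr.
pose q : {poly R} := y%:P + (z - y) *: 'X.
rewrite (@eq_integ _ _ _ _ (horner p)); last by move=> t _; rewrite peval_coord.
rewrite (integ_subst (xface_lt i)); last exact: cont_on_poly.
rewrite zy integ_scale; last first.
  move=> t _.
  have -> : (fun t => p.[y + t * h]) = horner (p \Po q).
    by apply/funext => s; rewrite horner_comp horner_affine zy.
  exact: continuous_horner.
rewrite mulKf ?gt_eqF//.
rewrite (@eq_integ _ _ _ _ (horner (p \Po q))); last first.
  by move=> t _; rewrite horner_comp horner_affine zy.
rewrite -ex; last first.
  have sq : (size q <= 2)%N.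
    rewrite (leq_trans (size_polyD _ _))// geq_max size_polyC.
    by rewrite (leq_trans (size_scale_leq _ _)) ?size_polyX// andbT; case: (_ != _).
  apply: (leq_trans (size_comp_poly_leq _ _)); have sp := leq_trans (hU i j) hkN.
  have : ((size p).-1 * (size q).-1 <= N.+1 * 1)%N
    by apply: leq_mul; [rewrite -ltnS; case: (size p) sp|rewrite -ltnS; case: (size q) sq].
  lia.
apply: eq_bigr => r _; rewrite mxE peval_coord horner_comp horner_affine.
by rewrite zy.
Qed.

(** Node [q] moves with ratio [mu / w q], so that averaging with the weights restores [mu]; this is
    the origin of the factors omega_q in the CFL condition. Nodes that do not move take [t q = 0]
    and [e q = 0]. *)
Lemma node_update i mu (t : 'I_N.+2 -> state R M) (e : 'I_N.+2 -> R) T E :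
  in_Vh k U -> \sum_q t q = T -> \sum_q e q = E ->
  (forall q, G (peval (U i) (node i q) - (mu / w q) *: t q) /\
    entropy (peval (U i) (node i q) - (mu / w q) *: t q)
    <= entropy (peval (U i) (node i q)) - mu / w q * e q) ->
  G (cell_average x0 h U i - mu *: T) /\
  entropy (cell_average x0 h U i - mu *: T) <= cell_entropy x0 h xhat w U i - mu * E.
Proof.
move=> hU <- <- H; rewrite (cell_average_node i hU).
have w0 q : 0 < w q := gl_weight_gt0 hGL q.
pose c q := peval (U i) (node i q) - (mu / w q) *: t q.
have -> : \sum_q w q *: peval (U i) (node i q) - mu *: \sum_q t q = \sum_q w q *: c q.
  rewrite scaler_sumr -sumrB; apply: eq_bigr => q _.
  by rewrite scalerBr scalerA mulrCA divff ?gt_eqF// mulr1.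
have w0' q : 0 <= w q by exact: ltW.
have hc q : w q != 0 -> G (c q) by case: (H q).
split; first exact: (G_convex w0' (gl_sum1 hGL) hc).
apply: (le_trans (entropy_jensen w0' (gl_sum1 hGL) hc)).
rewrite /cell_entropy mulr_sumr -sumrB; apply: ler_sum => q _.
have [_ /(ler_wpM2l (w0' q))] := H q.
suff <- : w q * (entropy (peval (U i) (node i q)) - mu / w q * e q) =
    w q * entropy (peval (U i) (node i q)) - mu * e q by [].
by move: (entropy _) (gt_eqF (w0 q)) => x /negbT wn0; field.
Qed.

End Quadrature.

Section Step.
Context (L : system R M) (hL : entropic L) (hPsi : prescribed_path Psi).
Hypothesis hspeed : forall a b Phi, G a -> G b -> generalized_path a b Phi ->
  SL L a b Phi < SR L a b Phi.

Lemma fluct_sum a b Phi : SL L a b Phi < SR L a b Phi ->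
  fluct_neg L a b Phi + fluct_pos L a b Phi = pathJ L Phi.
Proof.
move=> s; rewrite /fluct_neg /fluct_pos -scalerDl -mulrDl addrC divff ?scale1r//.
by rewrite subr_eq0 gt_eqF.
Qed.

(* A pair of states on which the numerical flux satisfies both one-sided entropy
   inequalities; for equal states these need the path integral to vanish. *)
Definition entropy_pair a b Phi :=
  [/\ G a, G b, SL L a b Phi < SR L a b Phi & a <> b \/ pathJ L Phi = 0].

Lemma three_point_update mu a b c Phi1 Phi2 : 0 <= mu ->
  entropy_pair a b Phi1 -> entropy_pair b c Phi2 -> cfl3 L mu a b c Phi1 Phi2 ->
  G (b - mu *: T3 L a b c Phi1 Phi2) /\
  entropy (b - mu *: T3 L a b c Phi1 Phi2)
  <= entropy b - mu * (num_eflux L b c Phi2 - num_eflux L a b Phi1).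
Proof.
move=> mu0 [Ga Gb s1 j1] [_ Gc s2 j2] hc; split; first by case: hc.
by apply: three_point => //; [exact: T1_le0|exact: T2_ge0].
Qed.

Context (k N : nat) (hkN : (k.+1 <= N.+2)%N) (xhat w : 'I_N.+2 -> R).
Hypothesis hGL : gauss_lobatto xhat w.
Context (U : dgfun R M) (hU : in_Vh k U).
Hypothesis hG : forall i, admissible_on x0 h U i.

Lemma trace_minusS i : trace_minus x0 h U (i + 1) = peval (U i) (xface x0 h (i + 1)).
Proof. by rewrite /trace_minus addrK. Qed.

Lemma G_trace_minus i : G (trace_minus x0 h U i).
Proof.
rewrite -[i](subrK 1) trace_minusS; apply: hG.
by rewrite lexx andbT ltW// xface_lt.
Qed.

Lemma G_trace_plus i : G (trace_plus x0 h U i).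
Proof. by apply: hG; rewrite lexx ltW// xface_lt. Qed.

Lemma face_entropy_pair i : entropy_pair (trace_minus x0 h U i)
  (trace_plus x0 h U i) (face_path x0 h Psi U i).
Proof.
have Gm := G_trace_minus i; have Gp := G_trace_plus i; have [hp hc] := hPsi.
split=> //; first by apply: hspeed => //; exact: hp.
have [e|/eqP ne] := eqVneq (trace_minus x0 h U i) (trace_plus x0 h U i); last by left.
right; apply: (pathJ_const L (a := trace_plus x0 h U i)) => t t01.
by rewrite /face_path e hc.
Qed.

Lemma cell_entropy_pair i y z : xface x0 h i <= y -> y < z -> z <= xface x0 h (i + 1) ->
  peval (U i) y <> peval (U i) z ->
  entropy_pair (peval (U i) y) (peval (U i) z) (cell_path U i y z).
Proof.
move=> iy yz zi ne; have hx x : y <= x <= z -> G (peval (U i) x).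
  by move=> /andP[yx xz]; apply: hG; rewrite (le_trans iy) ?(le_trans xz).
have Gy : G (peval (U i) y) by apply: hx; rewrite lexx ltW.
have Gz : G (peval (U i) z) by apply: hx; rewrite lexx ltW.
split=> //; last by left.
by apply: hspeed => //; exact: cell_path_generalized.
Qed.

(** The cell average after a forward Euler step of length [mu * h], as [cell_average_DG] shows. *)
Definition fe_update mu i : state R M :=
  cell_average x0 h U i - mu *:
    (face_flux x0 h Psi L U (i + 1) - face_flux x0 h Psi L U i
     + face_neg x0 h Psi L U (i + 1) + face_pos x0 h Psi L U i
     + vinteg (xface x0 h i) (xface x0 h (i + 1)) (cell_source L U i)).

(** The N + 2 nodes are distinct and exceed the degree, so a polynomial vanishing at all of them is
    zero. *)
Lemma cell_constant i u :
  (forall q, peval (U i) (node x0 h xhat i q) = u) -> U i = pconst u.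
Proof.
move=> hu; apply/rowP => j; rewrite mxE; apply/eqP; rewrite -subr_eq0; apply/eqP.
pose s := [seq node x0 h xhat i q | q <- enum 'I_N.+2].
apply: (roots_geq_poly_eq0 (rs := s)).
- apply/allP => _ /mapP[q _ ->]; rewrite rootE hornerD hornerN hornerC subr_eq0.
  by rewrite -(hu q) peval_coord.
- rewrite map_inj_uniq ?enum_uniq// => q r /addrI/(mulIf (lt0r_neq0 hh)).
  exact: (gl_node_inj hGL).
- rewrite size_map size_enum_ord; apply: leq_trans (size_polyD _ _) _.
  rewrite geq_max size_polyN size_polyC (leq_trans (hU i j) hkN)/=.
  by case: (_ != _).
Qed.

Lemma forward_euler mu i : 0 <= mu ->
  weak_entropy_cfl x0 h Psi xhat w L U i mu ->
  G (fe_update mu i) /\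
  entropy (fe_update mu i) <= cell_entropy x0 h xhat w U i
    - mu * (face_eflux x0 h Psi L U (i + 1) - face_eflux x0 h Psi L U i).
Proof.
move=> mu0 [c1 c2 c3].
have w0 q : 0 < w q := gl_weight_gt0 hGL q.
have mw0 q : 0 <= mu / w q by rewrite divr_ge0// ltW.
have hL0 := face_entropy_pair i; have hR0 := face_entropy_pair (i + 1).
have eL : peval (U i) (node x0 h xhat i ord0) = trace_plus x0 h U i by rewrite (node0 hGL).
have eR : peval (U i) (node x0 h xhat i ord_max) = trace_minus x0 h U (i + 1).
  by rewrite (node_max hGL) trace_minusS.
have e01 : (ord0 : 'I_N.+2) != ord_max by [].
have Gn q : G (peval (U i) (node x0 h xhat i q)) by apply: hG; exact: (node_itv hGL).
have triv q : G (peval (U i) (node x0 h xhat i q) - (mu / w q) *: 0) /\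
    entropy (peval (U i) (node x0 h xhat i q) - (mu / w q) *: 0)
    <= entropy (peval (U i) (node x0 h xhat i q)) - mu / w q * 0.
  by rewrite scaler0 mulr0 !subr0.
have hGi x : xface x0 h i <= x <= xface x0 h (i + 1) -> G (peval (U i) x) by exact: hG.
have [eq|/eqP ne] := eqVneq (trace_plus x0 h U i) (trace_minus x0 h U (i + 1)); last first.
  (* Case of different end traces: only the two end nodes move, and they share the path across the
     whole cell. *)
  have [cL cR] := c1 ne.
  have hC : entropy_pair (trace_plus x0 h U i) (trace_minus x0 h U (i + 1))
      (cell_path U i (xface x0 h i) (xface x0 h (i + 1))).
    by move: ne; rewrite trace_minusS; apply: cell_entropy_pair => //; exact: xface_lt.
  set Phi := cell_path _ _ _ _ in cL cR hC.
  have uL := three_point_update (mw0 ord0) hL0 hC cL.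
  have uR := three_point_update (mw0 ord_max) hC hR0 cR.
  set tL := T3 _ _ _ _ _ _ in uL; set tR := T3 _ _ _ _ _ _ in uR.
  set vL := num_eflux _ _ _ _ - num_eflux _ _ _ _ in uL.
  set vR := num_eflux _ _ _ _ - num_eflux _ _ _ _ in uR.
  have [_ _ sC _] := hC.
  apply: (node_update hkN hGL hU
    (t := fun q => if q == ord0 then tL else if q == ord_max then tR else 0)
    (e := fun q => if q == ord0 then vL else if q == ord_max then vR else 0)).
  - apply: etrans (sum_if2 _ _ e01) _.
    rewrite -(pathJ_cell_path hL (xface_lt i) hGi) -(fluct_sum sC).
    exact: telescope2.
  - by apply: etrans (sum_if2 _ _ e01) _; rewrite /vL /vR addrC addrA subrK.
  - move=> q; case: eqVneq => [->|_]; first by rewrite eL.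
    by case: eqVneq => [->|_]; [rewrite eR|exact: triv].
have [ex|al] := pselect (exists2 s : 'I_N.+2, (0 < s < N.+1)%N &
    peval (U i) (node x0 h xhat i s) <> trace_plus x0 h U i).
  (* Case of a closed, nonconstant cell path: the node [s] cuts it into two paths with different end
     states, and three nodes move. *)
  have [s [si ne cL cM cR]] := c2 eq ex.
  have /andP[is_ si_] := node_int hGL i si.
  have hCL : entropy_pair (trace_plus x0 h U i) (peval (U i) (node x0 h xhat i s))
      (cell_path U i (xface x0 h i) (node x0 h xhat i s)).
    by apply: cell_entropy_pair => //; [exact: ltW|move=> e; apply: ne].
  have hCR : entropy_pair (peval (U i) (node x0 h xhat i s)) (trace_minus x0 h U (i + 1))
      (cell_path U i (node x0 h xhat i s) (xface x0 h (i + 1))).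
    rewrite trace_minusS; apply: cell_entropy_pair => //; first exact: ltW.
    by rewrite -trace_minusS -eq.
  set PhiL := cell_path _ _ _ _ in cL cM hCL; set PhiR := cell_path _ _ _ _ in cM cR hCR.
  have uL := three_point_update (mw0 ord0) hL0 hCL cL.
  have uM := three_point_update (mw0 s) hCL hCR cM.
  have uR := three_point_update (mw0 ord_max) hCR hR0 cR.
  set tL := T3 _ _ _ _ _ _ in uL; set tR := T3 _ _ _ _ _ _ in uR.
  set tM := T3 _ _ _ _ _ _ in uM.
  set vL := num_eflux _ _ _ _ - num_eflux _ _ _ _ in uL.
  set vR := num_eflux _ _ _ _ - num_eflux _ _ _ _ in uR.
  set vM := num_eflux _ _ _ _ - num_eflux _ _ _ _ in uM.
  have s0 : s != ord0 by apply: contraTneq si => ->.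
  have s1 : s != ord_max by apply: contraTneq si => ->; rewrite ltnn andbF.
  have [_ _ sL _] := hCL; have [_ _ sR _] := hCR.
  apply: (node_update hkN hGL hU
    (t := fun q => if q == ord0 then tL else if q == ord_max then tR else if q == s then tM else 0)
    (e := fun q => if q == ord0 then vL else if q == ord_max then vR else if q == s then vM else 0)).
  - apply: etrans (sum_if3 _ _ _ e01 s0 s1) _.
    rewrite -(pathJ_cell_path hL (xface_lt i) hGi) -(pathJ_cell_path_split hL is_ si_ hGi).
    by rewrite -(fluct_sum sL) -(fluct_sum sR); exact: telescope3.
  - apply: etrans (sum_if3 _ _ _ e01 s0 s1) _; rewrite /vL /vR /vM /face_eflux.
    move: (num_eflux _ _ _ _) (num_eflux _ _ _ _) (num_eflux _ _ _ _) (num_eflux _ _ _ _).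
    by move=> x y z t; ring.
  - move=> q; case: eqVneq => [->|_]; first by rewrite eL.
    case: eqVneq => [->|_]; first by rewrite eR.
    by case: eqVneq => [->|_]; [|exact: triv].
(* Case of a constant cell: the source integral vanishes and the whole cell is the middle state of a
   single three-point scheme, with ratio [mu] and the two interface paths. *)
have al' (s : 'I_N.+2) : (0 < s < N.+1)%N -> peval (U i) (node x0 h xhat i s) = trace_plus x0 h U i.
  by move=> si; apply: contrapT => ne; apply: al; exists s.
have cst q : peval (U i) (node x0 h xhat i q) = trace_plus x0 h U i.
  have [->|q0] := eqVneq q ord0; first exact: eL.
  have [->|q1] := eqVneq q ord_max; first by rewrite eR eq.
  apply: al'; rewrite lt0n ltn_neqAle -ltnS ltn_ord andbT; apply/andP; split.
    by apply: contra q0 => /eqP e; apply/eqP/val_inj.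
  by apply: contra q1 => /eqP e; apply/eqP/val_inj.
have Uc := cell_constant cst; set u := trace_plus x0 h U i in cst Uc eq c3 *.
have avg : cell_average x0 h U i = u.
  rewrite (cell_average_node hkN hGL i hU); under eq_bigr do rewrite cst.
  by rewrite -scaler_suml (gl_sum1 hGL) scale1r.
have ent : cell_entropy x0 h xhat w U i = entropy u.
  rewrite /cell_entropy; under eq_bigr do rewrite cst.
  by rewrite -mulr_suml (gl_sum1 hGL) mul1r.
have src : vinteg (xface x0 h i) (xface x0 h (i + 1)) (cell_source L U i) = 0.
  rewrite -(pathJ_cell_path hL (xface_lt i) hGi); apply: (pathJ_const L (a := u)) => t _.
  by rewrite /cell_path Uc; apply/rowP => j; rewrite peval_coord mxE hornerC.
have cF := c3 eq al'; rewrite -eq in hR0 cF.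
have := three_point_update mu0 hL0 hR0 cF.
rewrite /fe_update avg ent src addr0 /face_flux /face_neg /face_eflux -eq.
exact.
Qed.

End Step.
End ForwardEuler.

(** * Multistep scheme and limiter *)

Section Stages.
Context {R : realType} {M : nat}.
Local Notation G := (@G R M).
Context (x0 h : R) (hh : 0 < h) (Psi : R -> state R M -> state R M -> state R M).
Context (k N : nat) (hkN : (k.+1 <= N.+2)%N) (xhat w : 'I_N.+2 -> R).
Hypothesis hGL : gauss_lobatto xhat w.
Implicit Types (i : int) (U LU : dgfun R M) (L : system R M).

Lemma pevalD (f g : 'rV[{poly R}]_(dimU M)) x : peval (f + g) x = peval f x + peval g x.
Proof. by apply/rowP => j; rewrite !mxE !horner_evalE hornerD. Qed.

Lemma pevalN (f : 'rV[{poly R}]_(dimU M)) x : peval (- f) x = - peval f x.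
Proof. by apply/rowP => j; rewrite !mxE !horner_evalE hornerN. Qed.

Lemma pevalZ (c : R) (f : 'rV[{poly R}]_(dimU M)) x :
  peval (c%:P *: f) x = c *: peval f x.
Proof. by apply/rowP => j; rewrite !mxE !horner_evalE hornerM hornerC. Qed.

Lemma peval_const (u : state R M) x : peval (pconst u) x = u.
Proof. by apply/rowP => j; rewrite !mxE !horner_evalE hornerC. Qed.

Lemma peval_sum m (f : 'I_m -> 'rV[{poly R}]_(dimU M)) x :
  peval (\sum_l f l) x = \sum_l peval (f l) x.
Proof.
apply: (big_morph (fun f => peval f x)) => [f1 g1|]; first exact: pevalD.
by apply/rowP => j; rewrite !mxE horner_evalE horner0.
Qed.

(** Tests the weak form with constant basis vectors, whose derivative kills the volume flux term. *)
Lemma cell_average_DG L U LU i : is_DG_operator x0 h Psi k L U LU ->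
  cell_average x0 h LU i = - (h^-1 *:
    (face_flux x0 h Psi L U (i + 1) - face_flux x0 h Psi L U i
     + face_neg x0 h Psi L U (i + 1) + face_pos x0 h Psi L U i
     + vinteg (xface x0 h i) (xface x0 h (i + 1)) (cell_source L U i))).
Proof.
move=> [_ hDG]; apply/rowP => j.
pose W : dgfun R M := fun=> pconst (delta_mx 0 j).
have hW : in_Vh k W.
  by move=> l c; rewrite mxE (leq_trans (size_polyC_leq1 _)).
have := hDG W hW i; rewrite /trace_minus /trace_plus !peval_const !dotv_delta.
have W' x : peval (pderiv (W i)) x = 0.
  by apply/rowP => l; rewrite !mxE horner_evalE derivC horner0.
under eq_integ do rewrite peval_const dotv_delta.
under [in X in X - _ + _ - _ - _ - _]eq_integ do rewrite W' dotv0r.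
under [in X in _ - X]eq_integ do rewrite peval_const dotv_delta mulrC.
have -> : integ (xface x0 h i) (xface x0 h (i + 1)) (fun=> 0) = 0 :> R.
  by rewrite /integ Rintegral_cst//= mul0r.
have -> : integ (xface x0 h i) (xface x0 h (i + 1))
     (fun x => mag_x (peval (pderiv (U i)) x) * source L (peval (U i) x) 0 j)
  = vinteg (xface x0 h i) (xface x0 h (i + 1)) (cell_source L U i) 0 j.
  by rewrite [RHS]mxE; apply: eq_integ => t _; rewrite /cell_source mxE.
move=> e; rewrite [cell_average _ _ _ _ _ _]mxE [vinteg _ _ _ 0 j]mxE e.
move: (face_flux _ _ _ _ _ _) (face_flux _ _ _ _ _ _) (face_neg _ _ _ _ _ _).
move: (face_pos _ _ _ _ _ _) (vinteg _ _ _) => a1 a2 a3 a4 a5.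
by rewrite !mxE; ring.
Qed.

Context (dt : R) (m : nat) (alpha beta : 'I_m.+1 -> R) (U LU : 'I_m.+1 -> dgfun R M).
Hypotheses (alpha_ge0 : forall l, 0 <= alpha l) (sum_alpha : \sum_(l < m.+1) alpha l = 1)
  (beta0 : forall l, alpha l = 0 -> beta l = 0) (hU : forall l, in_Vh k (U l))
  (hLU : forall l, is_stage_operator x0 h Psi k (beta l) (U l) (LU l)).

Definition stage_ratio l : R := `|beta l| / alpha l * (dt / h).

Lemma in_Vh_opp LU' : in_Vh k (fun i => - LU' i) -> in_Vh k LU'.
Proof. by move=> hL i c; have := hL i c; rewrite mxE size_polyN. Qed.

Lemma in_Vh_stage l : in_Vh k (LU l).
Proof.
have [] := hLU l; case: ifP => _ // hV _.
exact: in_Vh_opp.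
Qed.

Lemma in_Vh_predicted : in_Vh k (predicted dt alpha beta U LU).
Proof.
move=> i c; rewrite /predicted summxE; apply: (leq_trans (size_sum _ _ _)).
apply/bigmax_leqP => l _; rewrite !mxE !mul_polyC.
rewrite (leq_trans (size_polyD _ _))// geq_max.
rewrite (leq_trans (size_scale_leq _ _) (hU l i c)).
by rewrite (leq_trans (size_scale_leq _ _) (in_Vh_stage l i c)).
Qed.

Lemma cell_average_opp LU' i : in_Vh k (fun i => - LU' i) ->
  cell_average x0 h LU' i = - cell_average x0 h (fun i => - LU' i) i.
Proof.
move=> hL; rewrite !(cell_average_node x0 hh hkN hGL)//; last exact: in_Vh_opp.
by rewrite -sumrN; apply: eq_bigr => q _; rewrite pevalN scalerN opprK.
Qed.

Lemma cell_average_predicted i : cell_average x0 h (predicted dt alpha beta U LU) i =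
  \sum_l alpha l *: fe_update x0 h Psi (stage_system (beta l)) (U l) (stage_ratio l) i.
Proof.
have -> : cell_average x0 h (predicted dt alpha beta U LU) i = \sum_l
    (alpha l *: cell_average x0 h (U l) i + (beta l * dt) *: cell_average x0 h (LU l) i).
  rewrite (cell_average_node x0 hh hkN hGL _ in_Vh_predicted).
  under eq_bigr do rewrite peval_sum scaler_sumr.
  rewrite exchange_big; apply: eq_bigr => l _.
  rewrite (cell_average_node x0 hh hkN hGL _ (hU l)).
  rewrite (cell_average_node x0 hh hkN hGL _ (in_Vh_stage l)).
  rewrite !scaler_sumr -big_split; apply: eq_bigr => q _ /=.
  by rewrite pevalD !pevalZ scalerDr !scalerA ![w q * _]mulrC.
apply: eq_bigr => l _; rewrite /fe_update scalerBr; congr (_ + _).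
(* If [alpha l = 0], the ratio is 0 by the convention on division and [beta l = 0] by hypothesis, so
   the identity persists. *)
have am : alpha l * stage_ratio l = `|beta l| * dt / h.
  rewrite /stage_ratio; have [a0|a0] := eqVneq (alpha l) 0.
    by rewrite a0 beta0// normr0 !mul0r.
  by field; rewrite a0 gt_eqF.
rewrite [alpha l *: (_ *: _)]scalerA am.
(* For [beta l < 0] it is [- LU l] that is the operator of the reversed system; its sign turns
   [beta l] into its absolute value. *)
have := hLU l; rewrite /is_stage_operator /stage_system; case: ltP => b0 hD.
  rewrite cell_average_opp; last by case: hD.
  rewrite (cell_average_DG i hD) opprK [LHS]scalerA -[RHS]scaleNr; congr (_ *: _).
  by rewrite ltr0_norm// mulNr mulNr opprK.
by rewrite (cell_average_DG i hD) scalerN scalerA ger0_norm.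
Qed.

(** For negative [beta l], the minus sign in [stage_eflux] is what replaces [beta l] by its absolute
    value, matching the forward Euler inequality of the reversed system. *)
Lemma entropy_upE i : entropy_up x0 h Psi xhat w dt alpha beta U i = \sum_l
  alpha l * (cell_entropy x0 h xhat w (U l) i - stage_ratio l *
    (face_eflux x0 h Psi (stage_system (beta l)) (U l) (i + 1)
     - face_eflux x0 h Psi (stage_system (beta l)) (U l) i)).
Proof.
apply: eq_bigr => l _; rewrite [RHS]mulrBr [alpha l * (stage_ratio l * _)]mulrA.
congr (_ - _).
have -> : alpha l * stage_ratio l = `|beta l| * (dt / h).
  rewrite /stage_ratio; have [a0|a0] := eqVneq (alpha l) 0.
    by rewrite a0 beta0// normr0 !mul0r.
  by field; rewrite a0 gt_eqF.
rewrite /stage_eflux; case: ltP => b0; last by rewrite ger0_norm.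
by rewrite ltr0_norm// -opprD mulrN !mulNr.
Qed.

Context (hPsi : prescribed_path Psi) (hUG : forall l i, admissible_on x0 h (U l) i).
Hypothesis hspeed : forall L a b Phi, L = mhd R M \/ L = reversed (mhd R M) ->
  G a -> G b -> generalized_path a b Phi -> SL L a b Phi < SR L a b Phi.
Hypothesis dt_gt0 : 0 < dt.

Section Cell.
Context (i : int).
Hypothesis hpre : admissible_on x0 h (predicted dt alpha beta U LU) i.
Hypothesis hcfl : forall l, 0 < alpha l ->
  weak_entropy_cfl x0 h Psi xhat w (stage_system (beta l)) (U l) i (stage_ratio l).

Lemma entropy_1st_le_up :
  entropy_1st x0 h dt alpha beta U LU i <= entropy_up x0 h Psi xhat w dt alpha beta U i.
Proof.
have FE l : alpha l != 0 ->
    G (fe_update x0 h Psi (stage_system (beta l)) (U l) (stage_ratio l) i) /\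
    entropy (fe_update x0 h Psi (stage_system (beta l)) (U l) (stage_ratio l) i)
    <= cell_entropy x0 h xhat w (U l) i - stage_ratio l *
      (face_eflux x0 h Psi (stage_system (beta l)) (U l) (i + 1)
       - face_eflux x0 h Psi (stage_system (beta l)) (U l) i).
  move=> a0; have ap : 0 < alpha l by rewrite lt0r a0 alpha_ge0.
  apply: (forward_euler hh _ hPsi _ hkN hGL (hU l) (hUG l)) => //.
  - rewrite /stage_system; case: ifP => _; last exact: mhd_entropic.
    exact/reversed_entropic/mhd_entropic.
  - move=> a b Phi; apply: hspeed; rewrite /stage_system.
    by case: ifP => _; [right|left].
  - by rewrite /stage_ratio !mulr_ge0// ?invr_ge0 ?ltW.
  - exact: hcfl.
rewrite /entropy_1st cell_average_predicted entropy_upE.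
apply: (le_trans (entropy_jensen alpha_ge0 sum_alpha _)).
  by move=> l /FE[].
apply: ler_sum => l _; have [->|a0] := eqVneq (alpha l) 0; first by rewrite !mul0r.
by apply: ler_wpM2l => //; have [] := FE l a0.
Qed.

Let pre q := peval (predicted dt alpha beta U LU i) (node x0 h xhat i q).
Let avg := cell_average x0 h (predicted dt alpha beta U LU) i.

Lemma G_predicted q : G (pre q).
Proof. by apply: hpre; exact: (node_itv x0 hh hGL). Qed.

Lemma gl_weight_ge0 q : 0 <= w q.
Proof. exact/ltW/(gl_weight_gt0 hGL). Qed.

Lemma cell_average_predicted_node : avg = \sum_q w q *: pre q.
Proof. exact: (cell_average_node x0 hh hkN hGL _ in_Vh_predicted). Qed.

Lemma G_cell_average : G avg.
Proof.
rewrite cell_average_predicted_node.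
exact: (G_convex gl_weight_ge0 (gl_sum1 hGL) (fun q _ => G_predicted q)).
Qed.

(** Together with [entropy_1st_le_up] this puts [theta] in [0, 1]. *)
Lemma entropy_1st_le_high :
  entropy_1st x0 h dt alpha beta U LU i <= entropy_high x0 h xhat w dt alpha beta U LU i.
Proof.
rewrite /entropy_1st -/avg cell_average_predicted_node.
exact: (entropy_jensen gl_weight_ge0 (gl_sum1 hGL) (fun q _ => G_predicted q)).
Qed.

Lemma limited_entropy_le :
  cell_entropy x0 h xhat w (limited x0 h Psi xhat w dt alpha beta U LU) i
  <= entropy_up x0 h Psi xhat w dt alpha beta U i.
Proof.
set th := theta x0 h Psi xhat w dt alpha beta U LU i.
have l1 := entropy_1st_le_up; have l2 := entropy_1st_le_high.
have /andP[t0 t1] : 0 <= th <= 1.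
  rewrite /th /theta; case: ifP => _; first by rewrite ler01 lexx.
  by rewrite le_min ler01 ge_min lexx orbT !andbT divr_ge0// subr_ge0.
(* Convexity at each node bounds the limited cell entropy by the interpolation between U^1st and
   U^high with parameter [th]; the choice of [theta] keeps that value below U^up. *)
apply: (@le_trans _ _ (entropy_1st x0 h dt alpha beta U LU i
   + th * (entropy_high x0 h xhat w dt alpha beta U LU i - entropy_1st x0 h dt alpha beta U LU i))).
  have -> : entropy_1st x0 h dt alpha beta U LU i = \sum_q w q * entropy avg.
    by rewrite -mulr_suml (gl_sum1 hGL) mul1r.
  have wsum (f g : 'I_N.+2 -> R) : \sum_q f q + th * (\sum_q g q - \sum_q f q)
      = \sum_q (f q + th * (g q - f q)).
    by rewrite -sumrB mulr_sumr -big_split.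
  rewrite /entropy_high /cell_entropy wsum.
  apply: ler_sum => q _ /=; rewrite /limited pevalD pevalZ pevalD pevalN !peval_const.
  have fact (a b c d : R) : a * b + c * (a * d - a * b) = a * (b + c * (d - b)) by ring.
  rewrite fact; apply: ler_wpM2l; first exact: gl_weight_ge0.
  apply: entropy_convex; [exact: G_cell_average|exact: G_predicted|by rewrite t0].
rewrite /th /theta; case: eqVneq => [->|ne]; first by rewrite subrr mulr0 addr0.
rewrite -lerBrDl -ler_pdivlMr; first by rewrite ge_min lexx.
by rewrite subr_gt0 lt_neqAle eq_sym ne.
Qed.

End Cell.
End Stages.

(** * Sums over finite or infinite sets of cells *)

Section CellSums.
Context {R : realType} (I : set int).
Implicit Types (f g p n : int -> R) (c : R).
Local Open Scope ereal_scope.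

Lemma esumZl (a : int -> \bar R) c : (0 <= c)%R -> (forall i, 0 <= a i) ->
  \esum_(i in I) (c%:E * a i) = c%:E * \esum_(i in I) a i.
Proof.
have le (b : int -> \bar R) d : (0 < d)%R -> (forall i, 0 <= b i) ->
    \esum_(i in I) (d%:E * b i) <= d%:E * \esum_(i in I) b i.
  move=> d0 b0; apply: ge_ereal_sup => _ [X [finX XI] <-].
  rewrite -ge0_mule_fsumr//.
  by rewrite lee_pmul2l//; apply: esum_ge; exists X.
rewrite le_eqVlt => /predU1P[<- a0|c0 a0].
  by rewrite mul0e esum1// => i _; rewrite mul0e.
apply/eqP; rewrite eq_le le//=.
(* The reverse inequality is the first one applied to the scaled family with factor 1 / c. *)
have := le (fun i => c%:E * a i) (c^-1)%R; rewrite invr_gt0 => /(_ c0).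
have -> : \esum_(i in I) (c^-1%:E * (c%:E * a i)) = \esum_(i in I) a i.
  by apply: eq_esum => i _; rewrite muleA -EFinM mulVf ?mul1e// gt_eqF.
by rewrite lee_pdivlMl//; apply=> i; rewrite mule_ge0// lee_fin ltW.
Qed.

Lemma summable_onD f g : summable_on I f -> summable_on I g ->
  summable_on I (fun i => f i + g i)%R.
Proof. by move=> hf hg; exact: (summableD hf hg). Qed.

Lemma summable_onN f : summable_on I f -> summable_on I (fun i => - f i)%R.
Proof. by rewrite /summable_on summableN. Qed.

Lemma summable_onZ c f : summable_on I f -> summable_on I (fun i => c * f i)%R.
Proof.
rewrite /summable_on /summable => hf.
have -> : \esum_(x in I) `|(EFin \o (fun i => c * f i)%R) x| =
    \esum_(x in I) (`|c|%:E * `|(EFin \o f) x|).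
  by apply: eq_esum => i _; rewrite /= normrM EFinM.
rewrite esumZl//.
by rewrite lte_mul_pinfty.
Qed.

Lemma summable_on_ge0_fin p : (forall i, I i -> 0 <= p i)%R -> summable_on I p ->
  \esum_(i in I) (p i)%:E \is a fin_num.
Proof.
move=> p0; rewrite /summable_on summableE.
rewrite (@eq_esum _ _ _ _ (fun i => (p i)%:E))// => i Ii.
by rewrite /= ger0_norm ?p0.
Qed.

(** [cell_sum] is defined by positive and negative parts, which are not additive; any decomposition
    into nonnegative summable functions gives the same value, and linearity follows. *)
Lemma cell_sum_split f p n : (forall i, I i -> 0 <= p i)%R ->
  (forall i, I i -> 0 <= n i)%R -> summable_on I p -> summable_on I n ->
  (forall i, I i -> f i = p i - n i)%R ->
  cell_sum I f = (fine (\esum_(i in I) (p i)%:E) - fine (\esum_(i in I) (n i)%:E))%R.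
Proof.
move=> p0 n0 sp sn fE; rewrite /cell_sum.
have := esumB sp sn p0 n0.
have -> : \esum_(i in I) ((EFin \o p) \- (EFin \o n))^\+ i = \esum_(i in I) (EFin \o f)^\+ i.
  by apply: eq_esum => i Ii; rewrite !funeposE /= fE.
have -> : \esum_(i in I) ((EFin \o p) \- (EFin \o n))^\- i = \esum_(i in I) (EFin \o f)^\- i.
  by apply: eq_esum => i Ii; rewrite !funenegE /= fE.
move=> ->; rewrite fineB//; exact: summable_on_ge0_fin.
Qed.

Definition pos_part f i : R := (Num.max (f i) 0)%R.
Definition neg_part f i : R := (Num.max (- f i) 0)%R.

Lemma pos_part_ge0 f i : (0 <= pos_part f i)%R.
Proof. by rewrite le_max lexx orbT. Qed.

Lemma neg_part_ge0 f i : (0 <= neg_part f i)%R.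
Proof. by rewrite le_max lexx orbT. Qed.

Lemma part_split f i : (f i = pos_part f i - neg_part f i)%R.
Proof.
by rewrite /pos_part /neg_part !maxEle oppr_le0; case: (leP 0%R (f i)) => h; case: (leP (f i) 0%R); lra.
Qed.

Lemma summable_pos_part f : summable_on I f -> summable_on I (pos_part f).
Proof.
move=> /summable_funepos; rewrite /summable_on; congr (summable _ _ : Prop).
by apply/funext => i; rewrite funeposE /= -EFin_max.
Qed.

Lemma summable_neg_part f : summable_on I f -> summable_on I (neg_part f).
Proof.
move=> /summable_funeneg; rewrite /summable_on; congr (summable _ _ : Prop).
by apply/funext => i; rewrite funenegE /= -EFin_max.
Qed.

Lemma cell_sumE f : summable_on I f -> cell_sum I f =
  (fine (\esum_(i in I) (pos_part f i)%:E) - fine (\esum_(i in I) (neg_part f i)%:E))%R.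
Proof.
move=> sf; apply: cell_sum_split.
- by move=> i _; exact: pos_part_ge0.
- by move=> i _; exact: neg_part_ge0.
- exact: summable_pos_part.
- exact: summable_neg_part.
- by move=> i _; exact: part_split.
Qed.

Lemma fine_esumD p n : (forall i, I i -> 0 <= p i)%R -> (forall i, I i -> 0 <= n i)%R ->
  summable_on I p -> summable_on I n ->
  (fine (\esum_(i in I) (p i + n i)%:E) =
   fine (\esum_(i in I) (p i)%:E) + fine (\esum_(i in I) (n i)%:E))%R.
Proof.
move=> p0 n0 sp sn; rewrite -fineD; [|exact: summable_on_ge0_fin..].
by rewrite -esumD// => i Ii; rewrite lee_fin ?p0 ?n0.
Qed.

Lemma cell_sumD f g : summable_on I f -> summable_on I g ->
  cell_sum I (fun i => f i + g i)%R = (cell_sum I f + cell_sum I g)%R.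
Proof.
move=> sf sg.
have pf := pos_part_ge0 f; have nf := neg_part_ge0 f.
have pg := pos_part_ge0 g; have ng := neg_part_ge0 g.
have [spf snf] := (summable_pos_part sf, summable_neg_part sf).
have [spg sng] := (summable_pos_part sg, summable_neg_part sg).
rewrite (@cell_sum_split _ (fun i => pos_part f i + pos_part g i)%R
  (fun i => neg_part f i + neg_part g i)%R).
- rewrite (fine_esumD (fun i _ => pf i) (fun i _ => pg i) spf spg).
  rewrite (fine_esumD (fun i _ => nf i) (fun i _ => ng i) snf sng).
  by rewrite (cell_sumE sf) (cell_sumE sg) opprD addrACA.
- by move=> i _; rewrite addr_ge0.
- by move=> i _; rewrite addr_ge0.
- exact: summable_onD.
- exact: summable_onD.
- by move=> i _; rewrite {1}(part_split f) {1}(part_split g); lra.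
Qed.

Lemma cell_sumN f : summable_on I f -> cell_sum I (fun i => - f i)%R = (- cell_sum I f)%R.
Proof.
move=> sf; rewrite (@cell_sum_split _ (neg_part f) (pos_part f)).
- by rewrite (cell_sumE sf) opprB.
- by move=> i _; exact: neg_part_ge0.
- by move=> i _; exact: pos_part_ge0.
- exact: summable_neg_part.
- exact: summable_pos_part.
- by move=> i _; rewrite {1}(part_split f) opprB.
Qed.

Lemma cell_sumZ c f : summable_on I f ->
  cell_sum I (fun i => c * f i)%R = (c * cell_sum I f)%R.
Proof.
wlog c0 : c / (0 <= c)%R => [H sf|].
  have [c0|c0] := leP 0%R c; first exact: H.
  have -> : (fun i => c * f i)%R = (fun i => - (- c * f i))%R.
    by apply/funext => i; rewrite mulNr opprK.
  rewrite cell_sumN; last exact: summable_onZ.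
  by rewrite H ?oppr_ge0 ?(ltW c0)// mulNr opprK.
move=> sf; have [spf snf] := (summable_pos_part sf, summable_neg_part sf).
have E p : (forall i, 0 <= p i)%R -> summable_on I p ->
    fine (\esum_(i in I) (c * p i)%:E) = (c * fine (\esum_(i in I) (p i)%:E))%R.
  move=> p0 sp; under eq_esum do rewrite EFinM.
  rewrite esumZl//.
  by rewrite fineM//; exact: summable_on_ge0_fin.
rewrite (@cell_sum_split _ (fun i => c * pos_part f i)%R (fun i => c * neg_part f i)%R).
- rewrite (E _ (pos_part_ge0 f) spf) (E _ (neg_part_ge0 f) snf).
  by rewrite (cell_sumE sf) mulrBr.
- by move=> i _; rewrite mulr_ge0// pos_part_ge0.
- by move=> i _; rewrite mulr_ge0// neg_part_ge0.
- exact: summable_onZ.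
- exact: summable_onZ.
- by move=> i _; rewrite {1}(part_split f) mulrBr.
Qed.

Lemma cell_sum_ge0 f : (forall i, I i -> 0 <= f i)%R -> (0 <= cell_sum I f)%R.
Proof.
move=> f0; rewrite /cell_sum [X in _ - X]esum1 => [|i Ii]; last first.
  by rewrite funenegE /= max_r// lee_fin oppr_le0 f0.
by rewrite sube0 fine_ge0// esum_ge0// => i _; rewrite funeposE le_max lexx orbT.
Qed.

Lemma le_cell_sum f g : summable_on I f -> summable_on I g ->
  (forall i, I i -> f i <= g i)%R -> (cell_sum I f <= cell_sum I g)%R.
Proof.
move=> sf sg fg; rewrite -subr_ge0 -cell_sumN// -cell_sumD//; last exact: summable_onN.
by apply: cell_sum_ge0 => i Ii; rewrite subr_ge0 fg.
Qed.

Lemma cell_sum_sum m (F : 'I_m -> int -> R) : (forall l, summable_on I (F l)) ->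
  summable_on I (fun i => \sum_l F l i)%R /\
  cell_sum I (fun i => \sum_l F l i)%R = (\sum_l cell_sum I (F l))%R.
Proof.
elim: m F => [|m IH] F sF.
  have -> : (fun i => \sum_(l < 0) F l i)%R = (fun i => 0 * 0)%R.
    by apply/funext => i; rewrite big_ord0 mul0r.
  have s0 : summable_on I (fun=> 0%R : R).
    rewrite /summable_on /summable.
    apply: (le_lt_trans _ (ltry 0%R)); rewrite le_eqVlt; apply/orP; left.
    by apply/eqP/esum1 => i _; rewrite /= normr0.
  by split; [exact: summable_onZ|rewrite cell_sumZ// mul0r big_ord0].
have [s e] := IH (fun l => F (widen_ord (leqnSn m) l)) (fun l => sF _).
have -> : (fun i => \sum_(l < m.+1) F l i)%R =
    (fun i => \sum_(l < m) F (widen_ord (leqnSn m) l) i + F ord_max i)%R.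
  by apply/funext => i; rewrite big_ord_recr.
split; first exact: summable_onD.
by rewrite cell_sumD// e big_ord_recr.
Qed.

End CellSums.

(** * Cell entropy inequality and global entropy stability *)

Theorem theorem4p8 (R : realType) (M : nat) (hM : (M.+1 <= 3)%N)
    (x0 h dt : R) (hh : 0 < h) (hdt : 0 < dt)
    (k N : nat) (hkN : (k.+1 <= N.+2)%N)
    (xhat w : 'I_N.+2 -> R) (hGL : gauss_lobatto xhat w)
    (Psi : R -> state R M -> state R M -> state R M)
    (hPsi : prescribed_path Psi)
    (hspeed : forall (L : system R M) (a b : state R M) (Phi : R -> state R M),
       L = mhd R M \/ L = reversed (mhd R M) ->
       G a -> G b -> generalized_path a b Phi ->
       SL L a b Phi < SR L a b Phi)
    (m : nat) (alpha beta : 'I_m.+1 -> R)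
    (halpha : forall l, 0 <= alpha l)
    (hsum : \sum_(l < m.+1) alpha l = 1)
    (hbeta : forall l, alpha l = 0 -> beta l = 0)
    (U LU : 'I_m.+1 -> dgfun R M)
    (hU : forall l, in_Vh k (U l))
    (hUG : forall l i, admissible_on x0 h (U l) i)
    (hLU : forall l, is_stage_operator x0 h Psi k (beta l) (U l) (LU l))
    (* the cells of the mesh; the other values of U l are boundary data *)
    (cells : set int)
    (hpre : forall i, cells i ->
       admissible_on x0 h (predicted dt alpha beta U LU) i)
    (hcfl : forall i l, cells i -> 0 < alpha l ->
       weak_entropy_cfl x0 h Psi xhat w (stage_system (beta l)) (U l) i
         (`|beta l| / alpha l * (dt / h))) :
  let Ent l i := cell_entropy x0 h xhat w (U l) i in
  let EntNew i :=
    cell_entropy x0 h xhat w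
      (limited x0 h Psi xhat w dt alpha beta U LU) i in
  let dFlux l i :=
    stage_eflux x0 h Psi (beta l) (U l) (i + 1)
    - stage_eflux x0 h Psi (beta l) (U l) i in
  (forall i, cells i ->
     EntNew i <=
     \sum_(l < m.+1) (alpha l * Ent l i - beta l * (dt / h) * dFlux l i))
  /\
  ((forall l, summable_on cells (Ent l)) ->
   summable_on cells EntNew ->
   (forall l, summable_on cells (dFlux l)) ->
   (forall l, cell_sum cells (dFlux l) = 0) ->
   cell_sum cells EntNew <= \sum_(l < m.+1) alpha l * cell_sum cells (Ent l)
   /\
   \sum_(l < m.+1) alpha l * cell_sum cells (Ent l) <=
   \big[Num.max/cell_sum cells (Ent ord0)]_(l < m.+1) cell_sum cells (Ent l)).
Proof.
move=> Ent EntNew dFlux.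
have cell i : cells i -> EntNew i <=
    \sum_(l < m.+1) (alpha l * Ent l i - beta l * (dt / h) * dFlux l i).
  move=> ci; exact: (limited_entropy_le hh hkN hGL halpha hsum hbeta hU hLU hPsi
    hUG hspeed hdt (hpre i ci) (fun l => hcfl i l ci)).
split=> // sE sN sF F0; clearbody Ent EntNew dFlux.
(* The contribution of one stage to the cell bound; summed over the cells it reduces to its entropy
   part, since the flux differences sum to 0. *)
pose T l i := alpha l * Ent l i + - (beta l * (dt / h)) * dFlux l i.
have sT l : summable_on cells (T l).
  by apply: summable_onD; apply: summable_onZ; [exact: sE|exact: sF].
have [sT' eT] := cell_sum_sum sT.
split.
  have -> : \sum_(l < m.+1) alpha l * cell_sum cells (Ent l)
      = \sum_(l < m.+1) cell_sum cells (T l).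
    apply: eq_bigr => l _; apply/esym.
    apply: etrans (cell_sumD (summable_onZ _ (sE l)) (summable_onZ _ (sF l))) _.
    by rewrite (cell_sumZ _ (sE l)) (cell_sumZ _ (sF l)) F0 mulr0 addr0.
  rewrite -eT; apply: le_cell_sum => // i /cell/le_trans; apply.
  by apply: ler_sum => l _; rewrite /T mulNr.
set mx := \big[Num.max/_]_(l < _) _.
apply: (@le_trans _ _ (\sum_(l < m.+1) alpha l * mx)).
  by apply: ler_sum => l _; apply: ler_wpM2l => //; exact: le_bigmax.
by rewrite -mulr_suml hsum mul1r.
Qed.
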